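(* Let $\mathcal{X} \subset \mathbb{R}^2$ be a set of $N$ points in general position (no three collinear). For $\theta \in [0,\pi)$ let $u_\theta = (\cos\theta, \sin\theta)$ and $u_\theta^\perp = (-\sin\theta, \cos\theta)$; a line with direction $u_\theta$ through a point $p_0$ has left side $\{p : \langle p - p_0, u_\theta^\perp\rangle > 0\}$ and right side $\{p : \langle p - p_0, u_\theta^\perp\rangle < 0\}$ (so for lines parallel to the $X$-axis the left side is the open half-plane above the line). For $k \le \lfloor N/2\rfloor$, a \emph{left $k$-set} (resp. \emph{right $k$-set}) of $\mathcal{X}$ is a subset $S \subseteq \mathcal{X}$ with $|S| = k$ for which there is such a directed line with $S$ on its left side (resp. right side) and $\mathcal{X}\setminus S$ on the other side; a \emph{$k$-set} is a set that is a left $k$-set or a right $k$-set. Let $f_l(k,\mathcal{X})$, $f_r(k,\mathcal{X})$, $f(k,\mathcal{X})$ be the numbers of left $k$-sets, right $k$-sets and $k$-sets of $\mathcal{X}$. For $L, R \subseteq \{1, \ldots, \lfloor (N-1)/2\rfloor\}$ define $$f(L,R,\mathcal{X}) = \sum_{k \in L\cap R} f(k,\mathcal{X}) + \sum_{k \in L\setminus R} f_l(k,\mathcal{X}) + \sum_{k \in R\setminus L} f_r(k,\mathcal{X}),$$ and write $f(K,\mathcal{X}) = f(K,K,\mathcal{X})$. For sets $A \subseteq \{1,\ldots,\lfloor N/2\rfloor\}$ and $B \subseteq \{1,\ldots,\lfloor (N-1)/2\rfloor\}$, let $C = A \cup \{N - b : b \in B\} = \{c_1 < \cdots < c_{n-1}\}$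 and let $\langle A, B\rangle$ be the composition $(k_1,\ldots,k_n)$ of $N$ with partial sums $k_1 + \cdots + k_j = c_j$ ($j = 1,\ldots,n-1$). Let $P(\langle A,B\rangle)$ be the multipermutohedron of this composition, i.e. the convex hull in $\mathbb{R}^N$ of all coordinate permutations of the vector consisting of $k_1$ ones, $k_2$ twos, $\ldots$, $k_n$ copies of $n$ in nondecreasing order, and let $\mathrm{diam}$ denote the diameter of its graph (1-skeleton) (equal to $0$ if it is a single point). Put $\bar L = \{1,\ldots,\lfloor N/2\rfloor\}\setminus L$ and $\bar R = \{1,\ldots,\lfloor (N-1)/2\rfloor\}\setminus R$. Then $$\mathrm{diam}(P(\langle L,R\rangle)) \le f(L,R,\mathcal{X}) - |L\cup R| + |L\cap R| \le \binom{N}{2} - \mathrm{diam}(P(\langle \bar L, \bar R\rangle)).$$ In particular, for $K \subseteq \{1,\ldots,\lfloor (N-1)/2\rfloor\}$, with $\bar K_1 = \{1,\ldots,\lfloor N/2\rfloor\}\setminus K$ and $\bar K_2 = \{1,\ldots,\lfloor (N-1)/2\rfloor\}\setminus K$, $$\mathrm{diam}(P(\langle K,K\rangle)) \le f(K,\mathcal{X}) \le \binom{N}{2} - \mathrm{diam}(P(\langle \bar K_1, \bar K_2\rangle)).$$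
   Context: The paper describes left/right $k$-sets as sets of $k$ points lying to the left/right of a line ''with respect to a directed reference line, the X-axis'', with the left of a horizontal line being the open half-plane above it; the precise convention above (directions with angle in $[0,\pi)$) is the rendering used here. The composition $\langle A,B\rangle$ is the one whose partial sums from the left that are at most $N/2$ are the elements of $A$ and whose partial sums from the right that are at most $(N-1)/2$ are the elements of $B$. *)

(* Defs.v *)
From mathcomp Require Import all_boot all_order all_algebra perm finmap.
From mathcomp Require Import all_classical all_reals all_analysis.

Set Implicit Arguments.
Unset Strict Implicit.
Unset Printing Implicit Defensive.

Import Order.TTheory GRing.Theory Num.Theory.

Local Open Scope classical_set_scope.
Local Open Scope fset_scope.
Local Open Scope ring_scope.

Section KSets.
Variable RR : realType.
Implicit Types (p : RR * RR) (X S : {fset RR * RR}) (theta : RR).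

(* <p - p0, u_theta^perp> with u_theta^perp = (- sin theta, cos theta): positive
   to the left of the line through p0 directed by u_theta, negative to its
   right, zero on it. *)
Definition side (p0 : RR * RR) theta p : RR :=
  (p.1 - p0.1) * - sin theta + (p.2 - p0.2) * cos theta.

Definition direction_angle theta := 0 <= theta < pi.

(* Every line of the plane has a direction of angle in [0, pi). *)
Definition collinear (p q r : RR * RR) : Prop :=
  exists (p0 : RR * RR) theta, [/\ direction_angle theta,
    side p0 theta p = 0, side p0 theta q = 0 & side p0 theta r = 0].

Definition general_position X : Prop :=
  forall p q r, p \in X -> q \in X -> r \in X ->
    p != q -> q != r -> p != r -> ~ collinear p q r.

Definition left_kset k X S : Prop :=
  [/\ S `<=` X, #|` S| = k &
   exists (p0 : RR * RR) theta, [/\ direction_angle theta,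
     forall p, p \in S -> 0 < side p0 theta p &
     forall p, p \in X `\` S -> side p0 theta p < 0]].

Definition right_kset k X S : Prop :=
  [/\ S `<=` X, #|` S| = k &
   exists (p0 : RR * RR) theta, [/\ direction_angle theta,
     forall p, p \in S -> side p0 theta p < 0 &
     forall p, p \in X `\` S -> 0 < side p0 theta p]].

Definition kset k X S : Prop := left_kset k X S \/ right_kset k X S.

Definition num_left_ksets k X : nat :=
  #|` [fset S in fpowerset X | `[< left_kset k X S >] ]|.

Definition num_right_ksets k X : nat :=
  #|` [fset S in fpowerset X | `[< right_kset k X S >] ]|.

Definition num_ksets k X : nat :=
  #|` [fset S in fpowerset X | `[< kset k X S >] ]|.

Definition num_LRsets (L R : {fset nat}) X : nat :=
  (\sum_(k <- L `&` R) num_ksets k X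
   + \sum_(k <- L `\` R) num_left_ksets k X
   + \sum_(k <- R `\` L) num_right_ksets k X)%N.

End KSets.

Section PolytopeGraph.
Variables (RR : realType) (n : nat).
Implicit Types (P F : set 'rV[RR]_n) (u v x : 'rV[RR]_n).

Definition convex_hull (G : set 'rV[RR]_n) : set 'rV[RR]_n :=
  smallest (@convex_set RR 'rV[RR]_n) G.

Definition dotp (c x : 'rV[RR]_n) : RR := \sum_(i < n) c 0 i * x 0 i.

(* A face is cut out by an inequality dotp c x <= a valid on P. *)
Definition is_face P F : Prop :=
  exists (c : 'rV[RR]_n) (a : RR),
    (forall x, P x -> dotp c x <= a) /\
    (forall x, F x <-> P x /\ dotp c x = a).

Definition is_vertex P v : Prop := is_face P [set v].

Definition is_edge P u v : Prop :=
  [/\ u <> v, is_vertex P u, is_vertex P v & is_face P (convex_hull [set u; v])].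

(* fset_set is the finite set with the given elements when there are finitely
   many of them, as is the case for the vertices of a polytope. *)
Definition vertices P : {fset 'rV[RR]_n} := fset_set [set v | is_vertex P v].

Definition edge_rel P : rel (vertices P) :=
  fun u v : vertices P => `[< is_edge P (val u) (val v) >].

End PolytopeGraph.

(* Least number of edges of a path from x to y; it is less than #|T| as soon as
   there is a path, and the value #|T| is returned when there is none. *)
Definition graph_dist (T : finType) (e : rel T) (x y : T) : nat :=
  find (fun d => [exists s : d.-tuple T, path e x s && (last x s == y)])
       (iota 0 #|T|).

Definition graph_diam (T : finType) (e : rel T) : nat :=
  (\max_(x : T) \max_(y : T) graph_dist e x y)%N.

Definition diam (RR : realType) (n : nat) (P : set 'rV[RR]_n) : nat :=
  graph_diam (@edge_rel RR n P).

Definition interval1 (m : nat) : {fset nat} := [fset k in iota 1 m].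

Definition cuts (N : nat) (A B : {fset nat}) : seq nat :=
  sort leq (A `|` [fset (N - b)%N | b in B]).

(* Consecutive differences of 0 < c_1 < ... < c_(n-1) < N. *)
Definition composition (N : nat) (A B : {fset nat}) : seq nat :=
  pairmap (fun a b => b - a)%N 0%N (rcons (cuts N A B) N).

(* k_1 ones, k_2 twos, and so on *)
Definition composition_word (ks : seq nat) : seq nat :=
  flatten [seq nseq (nth 0 ks i) i.+1 | i <- iota 0 (size ks)]%N.

Definition multipermutohedron (RR : realType) (N : nat) (ks : seq nat) :
    set 'rV[RR]_N :=
  let w : 'rV[RR]_N := \row_(j < N) (nth 0%N (composition_word ks) j)%:R in
  convex_hull [set col_perm s w | s in [set: 'S_N]].

Definition diam_mp (RR : realType) (N : nat) (A B : {fset nat}) : nat :=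
  diam (@multipermutohedron RR N (composition N A B)).

(* Main.v *)
(* Sort the points by height and rotate the direction from angle 0 to pi: the
   order of the points goes to its reverse through C(N,2) adjacent
   transpositions, one per pair, and the top k-set changes exactly at the swaps
   between positions k and k + 1. Hence k-sets count swaps: the quantity
   f(L,R,X) - |L u R| + |L n R| is the number of swaps at the cuts
   c in C = L u (N - R), provided that each pair lying on a horizontal line,
   which is tied at both ends of the rotation, is swapped at the proper end. The
   remaining swaps are at the complementary cuts, those of <Lbar, Rbar>.

   It remains to bound the diameter of P(<A,B>) by the number of swaps at its
   cuts. Two vertices are adjacent if they differ by the exchange of a value i
   and a value i + 1, so a vertex is an arrangement of the coordinates in N
   slots in which only the exchanges across a cut count. Replacing the swaps of
   the sequence by comparators gives a sorting network, since it sorts the reverse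
   permutation; sorting by the order of the slots of the target vertex is a walk
   to this vertex that uses at most the swaps at the cuts. *)
Require Import Defs.
From mathcomp Require Import all_boot all_order all_algebra perm finmap.
From mathcomp Require Import all_classical all_reals all_analysis.
From mathcomp Require Import zify ring lra.

Set Implicit Arguments.
Unset Strict Implicit.
Unset Printing Implicit Defensive.

Import Order.TTheory GRing.Theory Num.Theory.

Lemma card_ord_lt N m : m <= N -> #|[set i : 'I_N | i < m]| = m.
Proof.
move=> mN; rewrite -[RHS](card_ord m) -[RHS]sum1_card -sum1dep_card.
by rewrite (big_ord_narrow mN).
Qed.

(** * Sorting networks *)

Section Network.
Variable N : nat.
Implicit Types (g : 'S_N) (net : seq ('I_N * 'I_N)).

(** Permutations compose from left to right, so [tperm a b * g] exchanges the keys that [g] puts in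
    the slots [a] and [b]. *)
Definition compare_exchange g (ab : 'I_N * 'I_N) : 'S_N :=
  if g ab.2 < g ab.1 then (tperm ab.1 ab.2 * g)%g else g.

Definition sorting_network net :=
  forall g, foldl compare_exchange g net = 1%g.

(** Thresholding the keys at [c] reduces them to zeros and ones, as in the 0-1 principle for sorting
    networks. *)
Definition num_ge g m c := #|[set s : 'I_N | (s < m) && (c <= g s)]|.

Lemma num_geS g (m : 'I_N) c :
  num_ge g m.+1 c = num_ge g m c + (c <= g m).
Proof.
rewrite /num_ge (cardsD1 m) !inE ltnS leqnn /= addnC; congr (_ + _).
apply: eq_card => s; by rewrite !inE ltnS andbA ltn_neqAle -val_eqE.
Qed.

Lemma num_ge_compare_exchange_neq g (a b : 'I_N) m c :
  b = a.+1 :> nat -> m <> b :> nat ->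
  num_ge (compare_exchange g (a, b)) m c = num_ge g m c.
Proof.
move=> ba mb; rewrite /compare_exchange /=; case: ifP => // _.
rewrite /num_ge -[RHS](card_preimset _ (@perm_inj _ (tperm a b))).
apply: eq_card => s; rewrite !inE permM; congr (_ && _).
by case: tpermP => [->|->|//]; lia.
Qed.

(** After the comparator, slot [a] holds the smaller key. If this key is below [c], the count at [b]
    is the count at [a]; otherwise both keys reach [c], and it is one less than the count at
    [b + 1]. *)
Lemma num_ge_compare_exchange_eq g (a b : 'I_N) c :
  b = a.+1 :> nat ->
  num_ge (compare_exchange g (a, b)) b c
  <= maxn (num_ge g a c) (num_ge g b.+1 c).-1.
Proof.
move=> ba; rewrite (num_geS g b) !ba !num_geS.
rewrite num_ge_compare_exchange_neq //; last lia.
rewrite /compare_exchange /=; case: ifP => [gba|/negbT gab]; last lia.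
by rewrite permM tpermL; lia.
Qed.

Lemma perm_le1 g : (forall s, g s <= s) -> g = 1%g.
Proof.
move=> gle; apply/permP => s; rewrite perm1.
have [m] := ubnP (val s); elim: m s => // m IH s sm.
have := gle s; rewrite leq_eqVlt => /orP[/eqP/val_inj //|gs].
by apply: (@perm_inj _ g); apply: IH; apply: leq_trans gs _.
Qed.

End Network.
Arguments compare_exchange {N}.

(** * Sequences of swaps from an order to its reverse *)

(* The list e gives the order in which the pairs i < j are swapped, starting from
   the identity; rho_triple ensures that above t is a linear order. *)
Section SwapSequence.
Variables (N : nat) (e : seq ('I_N * 'I_N)).
Implicit Types (i j k x : 'I_N) (t m c : nat).
Let rho i j := index (i, j) e.

Hypothesis e_uniq : uniq e.
Hypothesis mem_e : forall ij, (ij \in e) = (ij.1 < ij.2).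
Hypothesis rho_triple : forall i j k, i < j < k ->
  (rho i j < rho i k < rho j k) || (rho j k < rho i k < rho i j).

(** The order after the first [t] swaps, those of index less than [t]. *)
Definition above t i j :=
  (i < j) && (t <= rho i j) || (j < i) && (rho j i < t).

Lemma rho_lt i j : i < j -> rho i j < size e.
Proof. by move=> ij; rewrite index_mem mem_e. Qed.

Lemma rho_inj i j i' j' : i < j -> rho i j = rho i' j' -> (i, j) = (i', j').
Proof.
move=> ij rij; have eij : (i, j) \in e by rewrite mem_e.
rewrite -(nth_index (i, j) eij) -/(rho i j) rij nth_index //.
by rewrite -index_mem -/(rho i' j') -rij rho_lt.
Qed.

Lemma rho_surj t : t < size e -> exists i j, i < j /\ rho i j = t.
Proof.
case: e e_uniq mem_e @rho => // ij0 e' eu em rho' te.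
have := mem_nth ij0 te; rewrite em.
case E : (nth ij0 (ij0 :: e') t) => [i j] /= ij; exists i, j; split=> //.
by rewrite /rho' -E index_uniq.
Qed.

Lemma above_irr t i : above t i i = false.
Proof. by rewrite /above ltnn. Qed.

Lemma aboveN t i j : i != j -> above t j i = ~~ above t i j.
Proof. by rewrite /above -val_eqE /=; lia. Qed.

(** A cycle would need the outer pair of the triple to be swapped before or after both inner pairs,
    which [rho_triple] excludes. *)
Lemma above_trans t j i k : above t i j -> above t j k -> above t i k.
Proof.
rewrite /above.
move: (rho_triple (i := i) (j := j) (k := k)).
move: (rho_triple (i := i) (j := k) (k := j)).
move: (rho_triple (i := j) (j := i) (k := k)).
move: (rho_triple (i := j) (j := k) (k := i)).
move: (rho_triple (i := k) (j := i) (k := j)).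
move: (rho_triple (i := k) (j := j) (k := i)).
have [/val_inj <-|ik] := eqVneq (i : nat) k; lia.
Qed.

Definition pos t i := #|[set j | above t j i]|.

Lemma above_pos t i j : above t i j -> pos t i < pos t j.
Proof.
move=> ij; apply/proper_card/properP; split.
  by apply/fintype.subsetP => k; rewrite !inE => /above_trans; apply.
by exists i; rewrite !inE ?above_irr.
Qed.

Lemma pos_above t i j : i != j -> above t i j = (pos t i < pos t j).
Proof.
move=> ij; apply/idP/idP => [/above_pos //|]; apply: contraLR => nij.
by rewrite -leqNgt ltnW // above_pos // aboveN.
Qed.

Lemma pos_inj t : injective (pos t).
Proof.
move=> i j pij; apply/eqP; apply: contraT => ij.
have ji : j != i by rewrite eq_sym.
by have := aboveN t ij; rewrite (pos_above _ ij) (pos_above _ ji) pij ltnn.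
Qed.

Lemma pos_lt t i : pos t i < N.
Proof.
rewrite -[X in _ < X]card_ord -cardsT; apply/proper_card/properP.
by split; [apply/fintype.subsetP|exists i; rewrite !inE ?above_irr].
Qed.

Definition slot t i := Ordinal (pos_lt t i).

Lemma slot_inj t : injective (slot t).
Proof. by move=> i j [/pos_inj]. Qed.

Lemma pos0 i : pos 0 i = i.
Proof.
rewrite /pos -[RHS](card_ord_lt (ltnW (ltn_ord i))); apply: eq_card => j.
by rewrite !inE /above; lia.
Qed.

Lemma pos_end i : pos (size e) i = N - i.+1.
Proof.
have := cardsC [set j : 'I_N | j < i.+1]; rewrite card_ord_lt // card_ord.
move=> NE; apply: (@addnI i.+1); rewrite subnKC // -[RHS]NE; congr (_ + _).
apply: eq_card => j; rewrite !inE /above.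
by have [ji|ij] := ltnP j i; [have := rho_lt ji|have := @rho_lt i j]; lia.
Qed.

Section Swap.
Variables (i j : 'I_N).
Hypothesis ij : i < j.
Let t := rho i j.

Let neq_ij : i != j. Proof. by rewrite -val_eqE /=; lia. Qed.

Lemma above_swap : above t i j.
Proof. by rewrite /above ij leqnn. Qed.

Lemma aboveS_swap : above t.+1 j i.
Proof. by rewrite /above ij ltnSn orbT. Qed.

Lemma aboveS k l : (k, l) != (i, j) -> (k, l) != (j, i) ->
  above t.+1 k l = above t k l.
Proof.
move=> kl_ij kl_ji; rewrite /above /t.
have [kl|_] /= := ltnP k l.
  have : rho i j != rho k l.
    by apply: contraNneq kl_ij => /rho_inj ->.
  lia.
have [lk|//] /= := ltnP l k.
have : rho i j != rho l k.
  by apply: contraNneq kl_ji => /rho_inj -/(_ ij) [-> ->].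
lia.
Qed.

(** Two elements are adjacent when they are swapped: the step leaves their comparisons with [k]
    unchanged, and transitivity before it and after it gives the two implications. *)
Lemma above_between k : k != i -> k != j -> above t k i = above t k j.
Proof.
move=> ki kj; apply/idP/idP => [/above_trans|]; first by apply;
  exact: above_swap.
have kS l : above t.+1 k l = above t k l.
  by apply: aboveS; rewrite xpair_eqE ?(negPf ki) ?(negPf kj).
by rewrite -!kS => /above_trans; apply; exact: aboveS_swap.
Qed.

Lemma pos_swap : pos t j = (pos t i).+1.
Proof.
rewrite /pos (cardsD1 i) !inE above_swap; congr _.+1; apply: eq_card => k.
rewrite !inE; have [->|ki] /= := eqVneq k i; first by rewrite above_irr.
have [->|kj] := eqVneq k j; last by rewrite above_between.
by rewrite above_irr aboveN // above_swap.
Qed.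

Lemma posS_neq k : k != i -> k != j -> pos t.+1 k = pos t k.
Proof.
move=> ki kj; apply: eq_card => l; rewrite !inE aboveS //.
  by rewrite xpair_eqE (negPf kj) andbF.
by rewrite xpair_eqE (negPf ki) andbF.
Qed.

Lemma posS_upper : pos t.+1 i = (pos t i).+1.
Proof.
rewrite /pos (cardsD1 j) !inE aboveS_swap; congr _.+1; apply: eq_card => k.
rewrite !inE; have [->|kj] /= := eqVneq k j.
  by rewrite aboveN ?above_swap.
have [->|ki] := eqVneq k i; first by rewrite !above_irr.
by rewrite aboveS // xpair_eqE ?(negPf ki) ?(negPf kj).
Qed.

Lemma posS_lower : pos t.+1 j = pos t i.
Proof.
rewrite /pos; apply: eq_card => k; rewrite !inE.
have [->|kj] /= := eqVneq k j.
  by rewrite above_irr aboveN ?above_swap.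
have [->|ki] := eqVneq k i; last first.
  by rewrite aboveS ?above_between // xpair_eqE ?(negPf ki) ?(negPf kj).
by rewrite above_irr aboveN 1?eq_sym ?aboveS_swap.
Qed.

End Swap.

Definition swap_network :=
  [seq (slot (rho ij.1 ij.2) ij.1, slot (rho ij.1 ij.2) ij.2) | ij <- e].

Lemma swap_network_adjacent :
  {in swap_network, forall ab : 'I_N * 'I_N, ab.2 = ab.1.+1 :> nat}.
Proof.
by move=> _ /mapP[[i j] ije ->] /=; rewrite pos_swap //; rewrite mem_e in ije.
Qed.

(* x + c < N: x is at position at least c in the reverse of the initial order. *)
Let num_rev t m c := #|[set x : 'I_N | (x + c < N) && (pos t x < m)]|.

Let num_rev_mono t m m' c : m <= m' -> num_rev t m c <= num_rev t m' c.
Proof.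
move=> mm'; apply/subset_leq_card/fintype.subsetP => x;
  rewrite !inE => /andP[-> /=].
by lia.
Qed.

Let num_revS t m c : num_rev t m.+1 c <= (num_rev t m c).+1.
Proof.
rewrite /num_rev.
case: (pickP (fun x => pos t x == m)) => [x /eqP xm|no_m]; last first.
  rewrite leqW //; apply/subset_leq_card/fintype.subsetP => x;
    rewrite !inE ltnS.
  by rewrite [pos t x <= m]leq_eqVlt no_m.
rewrite (cardsD1 x); case: (x \in _) => /=;
  rewrite ?add0n ?add1n ?ltnS ?leqW //.
  apply/subset_leq_card/fintype.subsetP => y;
    rewrite !inE ltnS [_ <= m]leq_eqVlt -xm.
  by rewrite (inj_eq (@pos_inj t)); case: eqVneq.
apply/subset_leq_card/fintype.subsetP => y;
  rewrite !inE ltnS [_ <= m]leq_eqVlt -xm.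
by rewrite (inj_eq (@pos_inj t)); case: eqVneq.
Qed.

Let num_rev_swap i j m c : i < j -> m <> pos (rho i j) j ->
  num_rev (rho i j).+1 m c = num_rev (rho i j) m c.
Proof.
move=> ij; rewrite pos_swap // => mj.
apply: eq_card => x; rewrite !inE; congr (_ && _).
have [->|xj] := eqVneq x j; first by rewrite posS_lower ?pos_swap //; lia.
have [->|xi] := eqVneq x i; first by rewrite posS_upper //; lia.
by rewrite posS_neq.
Qed.

(** At time 0 the right-hand side is [minn m (N - c)], a bound for every permutation: there are [m]
    slots, and [N - c] keys that reach [c]. *)
Let num_ge_start (g : 'S_N) m c : m <= N -> c <= N ->
  num_ge g m c <= num_rev 0 m c.
Proof.
move=> mN cN; have -> : num_rev 0 m c = minn m (N - c).
  rewrite -[RHS](@card_ord_lt N); last lia.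
  by apply: eq_card => x; rewrite !inE pos0; lia.
rewrite leq_min -[X in _ <= X](card_ord_lt mN) subset_leq_card /=; last first.
  by apply/fintype.subsetP => s; rewrite !inE => /andP[].
rewrite -[N in N - c]card_ord -(cardsC [set s : 'I_N | s < c]) card_ord_lt //.
rewrite addKn -(card_preimset _ (@perm_inj _ g)).
by apply/subset_leq_card/fintype.subsetP => s; rewrite !inE -leqNgt => /andP[].
Qed.

(* A comparator at slots b - 1 and b only changes num_ge at b, where it replaces
   num_ge b by max(num_ge (b - 1), num_ge (b + 1) - 1). This is monotone, and
   the reverse permutation is swapped at each step: it bounds all the others. *)
Let num_ge_swaps (g : 'S_N) t m c : t <= size e -> m <= N -> c <= N ->
  num_ge (foldl compare_exchange g (take t swap_network)) m c <= num_rev t m c.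
Proof.
elim: t m => [|t IH] m; first by rewrite take0; move=> _; exact: num_ge_start.
move=> te mN cN; have [i [j [ij tE]]] := rho_surj te.
have ije : (i, j) \in e by rewrite mem_e.
have netE : nth (slot t i, slot t j) swap_network t = (slot t i, slot t j).
  by rewrite (nth_map (i, j)) // -tE nth_index.
rewrite (take_nth (slot t i, slot t j)) ?size_map // netE foldl_rcons.
have adj : slot t j = (slot t i).+1 :> nat by rewrite /= -tE pos_swap.
have stepE m' : m' <> pos t j -> num_rev t.+1 m' c = num_rev t m' c.
  by rewrite -tE; exact: num_rev_swap.
set g' := foldl _ _ _; have {}IH m' := IH m' (ltnW te).
have [mj|/eqP mj] := eqVneq m (pos t j); last first.
  rewrite num_ge_compare_exchange_neq //.
  by rewrite stepE //; exact: IH.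
have := num_ge_compare_exchange_eq g' c adj;
  rewrite -[X in num_ge _ X _]/(pos t j).
(* Both terms of the maximum are counts at slots other than [m], where the swap leaves [num_rev]
   unchanged. *)
rewrite -mj => /leq_trans; apply; rewrite geq_max; apply/andP; split.
  apply: leq_trans (IH _ (ltnW (ltn_ord _)) cN) _.
  rewrite -stepE; last by move: adj => /=; lia.
  by rewrite num_rev_mono // mj -tE pos_swap.
rewrite -subn1 leq_subLR add1n.
apply: leq_trans (num_revS _ _ _); rewrite stepE; last lia.
by rewrite mj; apply: IH => //; exact: pos_lt.
Qed.

(** For [m = c = s + 1] the final bound is zero: no key above [s] is left in the first [s + 1]
    slots. Hence each slot holds a key at most its index, which forces the identity. *)
Lemma swap_network_sorts : sorting_network swap_network.
Proof.
move=> g; apply: perm_le1 => s.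
have sN := ltn_ord s.
have := num_ge_swaps g (leqnn _) sN sN.
rewrite -{1}(size_map (fun ij => (slot (rho ij.1 ij.2) ij.1,
  slot (rho ij.1 ij.2) ij.2)) e) take_size.
have -> : num_rev (size e) s.+1 s.+1 = 0.
  by apply: eq_card0 => x; rewrite !inE pos_end; lia.
rewrite leqn0 cards_eq0 => /eqP/setP/(_ s); rewrite !inE ltnSn /=.
by move/negbT; rewrite -leqNgt.
Qed.

(** * Top and bottom sets of the successive orders *)

Definition top t (k : nat) := [set i : 'I_N | pos t i < k].

Lemma card_top t (k : nat) : k <= N -> #|top t k| = k.
Proof.
move=> kN; rewrite -[RHS](card_ord_lt kN) -[RHS](card_preimset _ (@slot_inj t)).
by apply: eq_card => i; rewrite !inE.
Qed.

Lemma above_top t (k : nat) i j : i \in top t k -> j \notin top t k -> above t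
  i j.
Proof.
rewrite !inE -leqNgt => ik kj; rewrite pos_above ?(leq_trans ik) //.
by apply: contraTneq ik => ->; rewrite -leqNgt.
Qed.

Lemma eq_top t (k : nat) (S : {set 'I_N}) : k <= N -> #|S| = k ->
  (forall i j, i \in S -> j \notin S -> above t i j) -> S = top t k.
Proof.
move=> kN Sk Sabove; apply/eqP; rewrite eqEcard card_top // Sk leqnn andbT.
apply/fintype.subsetP => i iS; rewrite inE -Sk; apply/proper_card/properP;
  split.
  apply/fintype.subsetP => j; rewrite inE => ji; apply: contraTT (ji) => jS.
  have neq_ji : j != i by apply: contraNneq jS => ->.
  by rewrite -(aboveN _ neq_ji) Sabove.
by exists i; rewrite // inE above_irr.
Qed.

Lemma top0 (k : nat) : top 0 k = [set i : 'I_N | i < k].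
Proof. by apply/setP => i; rewrite !inE pos0. Qed.

Lemma top_end (k : nat) : top (size e) k = [set i : 'I_N | N - i.+1 < k].
Proof. by apply/setP => i; rewrite !inE pos_end. Qed.

Lemma topC_end (k : nat) : k <= N -> ~: top (size e) (N - k) = top 0 k.
Proof.
by move=> kN; apply/setP => i; rewrite !inE pos0 pos_end; have := ltn_ord i;
  lia.
Qed.

Lemma topC0 (k : nat) : k <= N -> ~: top 0 (N - k) = top (size e) k.
Proof.
by move=> kN; apply/setP => i; rewrite !inE pos0 pos_end; have := ltn_ord i;
  lia.
Qed.

(** Slots are numbered from 0, so an adjacent comparator with second slot [k] acts across the
    boundary of the first [k] slots. *)
Definition swaps_at (k : nat) := count (fun ab : 'I_N * 'I_N => ab.2 == k :>
  nat).

Definition tops (n k : nat) := [set S in [seq top t k | t <- iota 0 n]].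

Lemma topsP (n k : nat) S : reflect (exists2 t, t < n & S = top t k) (S \in
  tops n k).
Proof.
rewrite inE; apply: (iffP mapP) => [] [t].
  by rewrite mem_iota => tn ->; exists t.
by move=> tn ->; exists t; rewrite // mem_iota.
Qed.

Lemma topsS (n k : nat) : tops n.+1 k = top n k |: tops n k.
Proof.
apply/setP => S; rewrite finset.in_setU1 !finset.in_set -addn1 iotaD map_cat
  mem_cat orbC.
by rewrite add0n mem_seq1.
Qed.

(* A swap at position k yields a new top k-set, since no pair is ever swapped
   back. *)
Lemma card_tops (n k : nat) : n <= size e ->
  #|tops n.+1 k| = (swaps_at k (take n swap_network)).+1.
Proof.
elim: n => [|n IH] ne.
  have -> : tops 1 k = [set top 0 k] by apply/setP => S; rewrite !inE.
  by rewrite cards1 take0.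
have [i [j [ij nE]]] := rho_surj ne.
have ije : (i, j) \in e by rewrite mem_e.
have netE : nth (slot n i, slot n j) swap_network n = (slot n i, slot n j).
  by rewrite (nth_map (i, j)) // -nE nth_index.
rewrite (take_nth (slot n i, slot n j)) ?size_map // netE /swaps_at -cats1.
rewrite count_cat /= addn0 -addSn -IH 1?ltnW // topsS cardsU1 addnC.
congr (_ + nat_of_bool _).
have pj : pos n j = (pos n i).+1 by rewrite -nE pos_swap.
have [pjk|pjk] /= := eqVneq (pos n j) k.
  apply/topsP => -[t tn /setP Ttop].
  have aij : above t i j by rewrite /above ij nE -ltnS tn.
  have := Ttop i; have := Ttop j; have := above_pos aij.
  by rewrite !inE -nE posS_lower // posS_upper // nE -pjk pj ltnS leqnn ltnn;
    lia.
apply/negbTE; rewrite negbK; apply/topsP; exists n => //.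
apply/setP => x; rewrite !inE.
have [->|xj] := eqVneq x j; first by rewrite -nE posS_lower // nE; lia.
have [->|xi] := eqVneq x i; first by rewrite -nE posS_upper // nE; lia.
by rewrite -nE posS_neq // nE.
Qed.

Definition all_tops (k : nat) := tops (size e).+1 k.

Definition all_bottoms (k : nat) := [set ~: S | S : {set 'I_N} in all_tops (N -
  k)].

Lemma card_all_tops (k : nat) : #|all_tops k| = (swaps_at k swap_network).+1.
Proof.
rewrite card_tops // -(size_map (fun ij => (slot (rho ij.1 ij.2) ij.1,
  slot (rho ij.1 ij.2) ij.2)) e).
by rewrite take_size.
Qed.

Lemma card_all_bottoms (k : nat) :
  #|all_bottoms k| = (swaps_at (N - k) swap_network).+1.
Proof. by rewrite card_imset ?card_all_tops //; exact: finset.setC_inj. Qed.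

(** A set on top at [t1] and at the bottom at [t2] has all its pairs with the complement in opposite
    orders at the two times. If [t1 <= t2], none of them is swapped before [t1], so the set is the
    initial top; otherwise all of them are, and it is the final top. *)
Lemma all_tops_bottomsI (k : nat) : k <= N ->
  all_tops k :&: all_bottoms k = [set top 0 k; top (size e) k].
Proof.
move=> kN; apply/setP => S; rewrite finset.in_setI finset.in_set2;
  apply/andP/orP; last first.
  case=> /eqP ->; split; try apply/topsP; try apply/imsetP.
  - by exists 0.
  - exists (top (size e) (N - k)); last by rewrite topC_end.
    by apply/topsP; exists (size e).
  - by exists (size e).
  - exists (top 0 (N - k)); last by rewrite topC0.
    by apply/topsP; exists 0.
case=> /topsP[t1 t1e S1] /imsetP[_ /topsP[t2 t2e ->] S2].
have Sk : #|S| = k by rewrite S1 card_top.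
have inS i j : i \in S -> j \notin S -> above t1 i j && above t2 j i.
  move=> iS jS; rewrite (above_top (k := k)) -?S1 //=.
  by apply: (above_top (k := N - k)); [move: jS|move: iS];
    rewrite S2 finset.in_setC ?negbK.
have [t12|t21] := leqP t1 t2; [left|right]; apply/eqP/eq_top => // i j iS jS.
  by have := inS i j iS jS; rewrite /above; lia.
have := inS i j iS jS; have := @rho_lt j i; rewrite /above; lia.
Qed.

Lemma card_all_tops_bottoms (k : nat) : 0 < k -> k.*2 < N ->
  #|all_tops k :|: all_bottoms k|
  = swaps_at k swap_network + swaps_at (N - k) swap_network.
Proof.
move=> k0 kN; rewrite cardsU all_tops_bottomsI; last lia.
rewrite card_all_tops card_all_bottoms cards2 (_ : _ != _) ?addSn ?addnS ?subSS
  ?subn0 //.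
have N0 : 0 < N by lia.
apply/eqP => /setP/(_ (Ordinal N0)); rewrite top0 top_end !inE /=; lia.
Qed.

End SwapSequence.

Local Open Scope ring_scope.

(** * Multipermutohedra *)

Section ConvexHull.
Local Open Scope classical_set_scope.
Variables (RR : realType) (n : nat).
Implicit Types (F G : set 'rV[RR]_n) (c x y : 'rV[RR]_n).

Lemma dotpD c x y : dotp c (x + y) = dotp c x + dotp c y.
Proof.
by rewrite /dotp -big_split; apply: eq_bigr => i _; rewrite mxE mulrDr.
Qed.

Lemma dotpZ c a x : dotp c (a *: x) = a * dotp c x.
Proof.
by rewrite /dotp mulr_sumr; apply: eq_bigr => i _; rewrite mxE mulrCA.
Qed.

Lemma dotp_conv c x y (k : {i01 RR}) :
  dotp c (conv k (x : convex_lmodType _) (y : convex_lmodType _)) =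
  k%:num * dotp c x + (1 - k%:num) * dotp c y.
Proof. by rewrite dotpD !dotpZ. Qed.

Lemma convex_convex_hull G : convex_set (convex_hull G).
Proof.
move=> x y k /set_mem xG /set_mem yG; apply/mem_set => A [/= Acvx GA].
by apply/set_mem/Acvx; apply/mem_set; [exact: xG|exact: yG].
Qed.

Lemma convex_set1 x : convex_set [set x].
Proof.
by move=> y z k /set_mem -> /set_mem ->; rewrite convmm; exact/mem_set.
Qed.

Lemma convex_dotp_eq c a : convex_set [set x | dotp c x = a].
Proof.
move=> x y k /set_mem/= xa /set_mem/= ya; apply/mem_set => /=.
by rewrite dotp_conv xa ya; ring.
Qed.

(** The points that satisfy the inequality, and lie in [F] in case of equality, form a convex set:
    equality at a proper convex combination forces it at both points. This set contains [G], hence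
    the hull. *)
Lemma convex_hull_face G F c a :
  (forall g, G g -> dotp c g <= a) -> (forall g, G g -> dotp c g = a -> F g) ->
  convex_set F -> F `<=` convex_hull G -> (forall x, F x -> dotp c x = a) ->
  is_face (convex_hull G) F.
Proof.
move=> Gle Geq Fcvx FG Fa; exists c, a.
have hull x : convex_hull G x -> dotp c x <= a /\ (dotp c x = a -> F x).
  move: x; apply: smallest_sub => [|g Gg]; last by split;
    [exact: Gle|exact: Geq].
  apply/convex_setW => x y /set_mem [xa xF] /set_mem [ya yF] k k0 k1.
  apply/mem_set; rewrite /= dotp_conv; split; first by nra.
  move=> xya; apply/set_mem/Fcvx; apply/mem_set; [apply: xF|apply: yF].
    by nra.
  by nra.
split=> [x /hull[]//|x]; split=> [Fx|[/hull[_]]]; last exact.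
by split; [exact: FG|exact: Fa].
Qed.

(** Otherwise every generator would satisfy the inequality strictly, and so would the whole hull,
    including [x]. *)
Lemma vertex_convex_hull G x : is_vertex (convex_hull G) x -> G x.
Proof.
move=> [c [a [Gle Fx]]].
have [xG xa] : convex_hull G x /\ dotp c x = a by exact/Fx.
apply: contrapT => nGx.
suff /(_ x xG) : convex_hull G `<=` [set z | dotp c z < a].
  by rewrite /= xa ltxx.
apply: smallest_sub => [|g Gg /=].
  apply/convex_setW => y z /set_mem/= ya /set_mem/= za k k0 k1.
  by apply/mem_set; rewrite /= dotp_conv; nra.
have hg : convex_hull G g by exact: sub_gen_smallest.
rewrite lt_neqAle Gle // andbT; apply/eqP => ga.
by have /= gx : [set x] g by [exact/Fx]; rewrite -gx in nGx.
Qed.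

End ConvexHull.

(** * Vertices and edges of a permutation polytope *)

Section PermutationPolytope.
Local Open Scope classical_set_scope.
Variables (RR : realType) (N : nat) (w : 'I_N -> nat).
Implicit Types (s t : 'S_N) (a b : 'I_N).

Definition perm_point s : 'rV[RR]_N := \row_j (w (s j))%:R.

Definition perm_points : set 'rV[RR]_N := range perm_point.

Lemma sum_perm_point (f : nat -> RR) s t :
  \sum_j f (w (s j)) = \sum_j f (w (t j)).
Proof.
have E (u : 'S_N) : \sum_j f (w (u j)) = \sum_j f (w j).
  by rewrite [RHS](reindex_inj (@perm_inj _ u)).
by rewrite !E.
Qed.

(* Sum over the coordinates the inequality (g - x)(g - y) >= 0, valid for
   natural numbers such that |x - y| <= 1. *)
Lemma perm_point_face s t u :
  (forall j, (w (s j) <= (w (t j)).+1)%N /\ (w (t j) <= (w (s j)).+1)%N) ->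
  let c := perm_point s + perm_point t in
  dotp c (perm_point u) <= dotp c (perm_point s) /\
  (dotp c (perm_point u) = dotp c (perm_point s) ->
   forall j, w (u j) = w (s j) \/ w (u j) = w (t j)).
Proof.
move=> near_st c.
pose d j : RR := ((w (u j))%:R - (w (s j))%:R) * ((w (u j))%:R - (w (t j))%:R).
have d_ge0 j : 0 <= d j.
  have [h1 h2] := near_st j; rewrite /d.
  have [le|gt] := leqP (w (u j)) (minn (w (s j)) (w (t j))).
    by rewrite mulr_le0 // subr_le0 ler_nat; lia.
  by rewrite mulr_ge0 // subr_ge0 ler_nat; lia.
have dE : dotp c (perm_point s) - dotp c (perm_point u) = \sum_j d j.
  have sq := sum_perm_point (fun m => m%:R ^+ 2) s u.
  rewrite /dotp -sumrB.
  (* The added difference of sums of squares is zero; with it the identity holds coordinate by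
     coordinate. *)
  transitivity (\sum_j d j + (\sum_j (w (s j))%:R ^+ 2
                              - \sum_j (w (u j))%:R ^+ 2) : RR); last first.
    by rewrite sq subrr addr0.
  rewrite -sumrB -big_split; apply: eq_bigr => j _.
  by rewrite !mxE /d /=; ring.
split; first by rewrite -subr_ge0 dE sumr_ge0.
move=> eq_us j; have /eqP : \sum_j d j = 0 by rewrite -dE eq_us subrr.
rewrite psumr_eq0 // => /allP/(_ j (mem_index_enum _)) /=.
rewrite mulf_eq0 !subr_eq0 !eqr_nat => /orP[]/eqP ->; [by left|by right].
Qed.

Lemma vertex_perm_point s :
  is_vertex (convex_hull perm_points) (perm_point s).
Proof.
have near_s j : (w (s j) <= (w (s j)).+1)%N /\ (w (s j) <= (w (s j)).+1)%N.
  by split.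
pose c := perm_point s + perm_point s.
apply: (@convex_hull_face _ _ _ _ c (dotp c (perm_point s))).
- by move=> _ [u _ <-]; have [] := perm_point_face u near_s.
- move=> _ [u _ <-] eq_us; have [_ /(_ eq_us) us] := perm_point_face u near_s.
  by apply/rowP => j; rewrite !mxE; case: (us j) => ->.
- exact: convex_set1.
- by move=> _ ->; apply: sub_gen_smallest; exists s.
- by move=> _ ->.
Qed.

(** The sum [c] of the two points defines the face: a maximizer among the generators agrees with one
    of them at each coordinate, hence with both off [p] and [q], and the coordinate sum ties its
    value at [q] to its value at [p]. *)
Lemma edge_perm_point s a b : w b = (w a).+1 ->
  is_edge (convex_hull perm_points) (perm_point s)
    (perm_point (s * tperm a b)%g).
Proof.
move=> wb; set t := (s * tperm a b)%g.
have neq_ab : a != b by apply/eqP => ab; rewrite ab in wb; lia.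
pose p := (s^-1)%g a; pose q := (s^-1)%g b.
have neq_pq : p != q by rewrite (inj_eq perm_inj).
have sp : s p = a by rewrite permKV.
have sq : s q = b by rewrite permKV.
have tp : t p = b by rewrite permM sp tpermL.
have tq : t q = a by rewrite permM sq tpermR.
have tE j : j != p -> j != q -> t j = s j.
  move=> jp jq; rewrite permM tpermD // eq_sym.
    by apply: contraNneq jp => sj; rewrite /p -sj permK.
  by apply: contraNneq jq => sj; rewrite /q -sj permK.
have near_st j : (w (s j) <= (w (t j)).+1)%N /\ (w (t j) <= (w (s j)).+1)%N.
  have [->|jp] := eqVneq j p; first by rewrite sp tp; lia.
  have [->|jq] := eqVneq j q; first by rewrite sq tq; lia.
  by rewrite tE.
have neq_st : perm_point s <> perm_point t.
  move/rowP/(_ p); rewrite !mxE sp tp => /eqP; rewrite eqr_nat; lia.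
split=> //; try exact: vertex_perm_point.
pose c := perm_point s + perm_point t.
apply: (@convex_hull_face _ _ _ _ c (dotp c (perm_point s))).
- by move=> _ [u _ <-]; have [] := perm_point_face u near_st.
- move=> _ [u _ <-] eq_us; have [_ /(_ eq_us) us] := perm_point_face u near_st.
  apply: sub_gen_smallest.
  have := sum_perm_point (fun m => m%:R) u s.
  rewrite (bigD1 p) //= (bigD1 q) 1?eq_sym //=.
  rewrite [RHS](bigD1 p) //= [X in _ = _ + X](bigD1 q) 1?eq_sym //= !addrA.
  under eq_bigr => j /andP[jp jq].
    have -> : w (u j) = w (s j) by case: (us j) => //; rewrite tE.
    over.
  move/addIr/eqP; rewrite -!natrD eqr_nat sp sq => /eqP sumE.
  have [up|up] : w (u p) = w a \/ w (u p) = w b.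
  + by rewrite -{1}sp -tp; exact: us.
  + left; apply/rowP => j; rewrite !mxE; congr _%:R.
    have [->|jp] := eqVneq j p; first by rewrite sp.
    have [->|jq] := eqVneq j q; first by rewrite sq; lia.
    by case: (us j) => //; rewrite tE.
  + right; apply/rowP => j; rewrite !mxE; congr _%:R.
    have [->|jp] := eqVneq j p; first by rewrite tp.
    have [->|jq] := eqVneq j q; first by rewrite tq; lia.
    by case: (us j) => //; rewrite tE.
- exact: convex_convex_hull.
- apply: smallest_sub; first exact: convex_convex_hull.
  by move=> _ [->|->]; apply: sub_gen_smallest; [exists s|exists t].
- apply: smallest_sub; first exact: convex_dotp_eq.
  move=> _ [->//|->] /=.
  (* Exchanging the roles of [s] and [t] gives the opposite inequality, so both points attain the
     maximum. *)
  have sym u : dotp c (perm_point u) =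
      dotp (perm_point t + perm_point s) (perm_point u) by rewrite /c addrC.
  have [le1 _] := perm_point_face t near_st.
  have near_ts j : (w (t j) <= (w (s j)).+1)%N /\ (w (s j) <= (w (t j)).+1)%N.
    by have [] := near_st j.
  have [le2 _] := perm_point_face s near_ts.
  by apply/eqP; rewrite eq_le le1 /= !sym.
Qed.

Lemma finite_vertices :
  finite_set [set v | is_vertex (convex_hull perm_points) v].
Proof.
apply: (@sub_finite_set _ _ perm_points); first exact: vertex_convex_hull.
apply: finite_image; exact: finite_finset.
Qed.

Lemma in_vertices v : (v \in vertices (convex_hull perm_points)) =
  `[< is_vertex (convex_hull perm_points) v >].
Proof.
by rewrite /vertices in_fset_set; last exact: finite_vertices.
Qed.

End PermutationPolytope.

Lemma graph_dist_le (T : finType) (e : rel T) (x : T) (p : seq T) :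
  path e x p -> (graph_dist e x (last x p) <= size p)%N.
Proof.
move=> ep; rewrite /graph_dist.
have [lt|ge] := ltnP (size p) #|T|; last first.
  by rewrite (leq_trans (find_size _ _)) // size_iota.
rewrite leqNgt; apply/negP => lt_find.
have := before_find 0%N lt_find; rewrite nth_iota // add0n.
by move=> /negbT/existsPn/(_ (in_tuple p)); rewrite ep /= eqxx.
Qed.

(** * Diameter bounds from sorting networks *)

Section NetworkDiameter.
Local Open Scope classical_set_scope.
Variable N : nat.
Implicit Types (g s t : 'S_N) (net : seq ('I_N * 'I_N)).

Section Diameter.
Variables (RR : realType) (w : 'I_N -> nat) (cut : pred nat).
Let P := convex_hull (@perm_points RR N w).

Lemma perm_point_in_vertices s : perm_point RR w s \in vertices P.
Proof. by rewrite in_vertices; apply/asboolP/vertex_perm_point. Qed.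

Let vtx s : vertices P := [` perm_point_in_vertices s]%fset.

(** The permutation [s^-1 * t] sends a slot to the target slot of the coordinate that occupies it. A
    comparator that acts multiplies it on the left by [tperm a b], that is, replaces [s] by
    [s * tperm a b]: this follows an edge at a cut, and stays at the same vertex when the two slots
    carry equal values. *)
Lemma network_path net :
  {in net, forall ab, w ab.2 = (w ab.1 + cut ab.2)%N} ->
  forall s t, foldl compare_exchange (s^-1 * t)%g net = 1%g ->
  exists2 p, path (@edge_rel RR N P) (vtx s) p &
    last (vtx s) p = vtx t /\ (size p <= count (fun ab : 'I_N * 'I_N => cut
      ab.2) net)%N.
Proof.
elim: net => [|[a b] net IH] wnet s t /=.
  move=> st; exists [::] => //; split=> //=.
  by congr vtx; rewrite -[s]mulg1 -st mulVKg.
have wab := wnet (a, b) (mem_head _ _).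
have {}IH := IH (fun ab abnet => wnet ab (mem_behead (s := _ :: _) abnet)).
rewrite /compare_exchange /=; case: ifP => _; last first.
  by move=> /IH[p ep [lp sp]]; exists p => //; split=> //; lia.
have -> : (tperm a b * (s^-1 * t))%g = ((s * tperm a b)^-1 * t)%g.
  by rewrite invgM tpermV mulgA.
move=> /IH[p ep [lp sp]]; case cutb : (cut b) wab => /= wab.
  exists (vtx (s * tperm a b)%g :: p); last by [].
  by rewrite /= ep andbT; apply/asboolP/edge_perm_point; rewrite wab addn1.
have <- : vtx (s * tperm a b)%g = vtx s by
  apply/val_inj/rowP => j; rewrite /= !mxE permM; case: tpermP => [->|->|//];
  rewrite wab addn0.
by exists p.
Qed.

Lemma diam_network net :
  {in net, forall ab, w ab.2 = (w ab.1 + cut ab.2)%N} -> sorting_network net ->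
  (diam P <= count (fun ab : 'I_N * 'I_N => cut ab.2) net)%N.
Proof.
move=> wnet sorts; rewrite /diam /graph_diam.
have ontoP (x : vertices P) : exists s, x = vtx s.
  have := valP x; rewrite in_vertices => /asboolP/vertex_convex_hull[s _ sx].
  by exists s; apply: val_inj.
apply/bigmax_leqP => x _; apply/bigmax_leqP => y _.
have [[s ->] [t ->]] := (ontoP x, ontoP y).
have [p ep [<-]] := network_path wnet (sorts (s^-1 * t)%g).
exact/leq_trans/graph_dist_le.
Qed.

End Diameter.
End NetworkDiameter.

(** Position [m] lies in the block that follows the cuts at most [m]. The start [a] and the offset
    [o] of the values are arbitrary so that the induction can drop the first block. *)
Lemma nth_block_word (cs : seq nat) (a b o m : nat) :
  path leq a (rcons cs b) -> (a <= m < b)%N ->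
  nth 0%N (flatten
    [seq nseq (nth 0 (pairmap (fun x y => y - x) a (rcons cs b)) i) (o + i).+1
      | i <- iota 0 (size cs).+1])%N (m - a)
  = (o + count (fun c => c <= m) cs).+1%N.
Proof.
elim: cs a o => [|c cs IH] a o /=.
  by move=> _ am; rewrite cats0 nth_nseq addn0 ifT //; lia.
move=> /andP[ac cs_path] am; rewrite nth_cat size_nseq.
have cb : (c <= b)%N.
  have := cs_path; rewrite (path_sortedE leq_trans) all_rcons.
  by case/andP => /andP[].
have all_cs : all (leq c) cs.
  by move/(order_path_min leq_trans): cs_path; rewrite all_rcons => /andP[].
case: ltnP => [mc|cm].
  rewrite nth_nseq mc (_ : c <= m = false)%N; last lia.
  rewrite (_ : count _ cs = 0)%N ?addn0 //; apply/eqP.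
  rewrite -leqn0 leqNgt -has_count; apply/hasPn => x /(allP all_cs) /=; lia.
rewrite subnBA // subnK //.
have cmb : (c <= m < b)%N by lia.
have := IH c o.+1 cs_path cmb.
rewrite (_ : c <= m)%N ?addnA ?addn1; last lia.
move <-; rewrite /= addn0; congr (nth _ (_ ++ flatten _) _).
  rewrite -[2%N]/(1 + 1)%N iotaDl -map_comp.
  by apply: eq_map => i /=; rewrite addnA addn1.
by case/andP: am.
Qed.

(** * Cuts of a composition *)

Section Composition.
Local Open Scope classical_set_scope.
Variables (N : nat) (A B : {fset nat}).

Definition cut_set (c : nat) : bool :=
  (c \in A) || ((c <= N)%N && ((N - c)%N \in B)).

Hypothesis bounded : forall c, (c \in A -> c < N)%N /\ (c \in B -> 0 < c < N)%N.

Lemma mem_cuts c : (c \in cuts N A B) = cut_set c.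
Proof.
rewrite mem_sort in_fsetU; congr (_ || _); apply/imfsetP/andP => /=.
  move=> [b bB ->]; have /andP[b0 bN] := (bounded b).2 bB.
  by rewrite leq_subr subKn // ltnW.
by move=> [cN cB]; exists (N - c)%N => //; rewrite subKn.
Qed.

Lemma composition_wordE m : (m < N)%N ->
  nth 0%N (composition_word (composition N A B)) m
  = (count (fun c => c <= m)%N (cuts N A B)).+1.
Proof.
move=> mN; rewrite /composition_word /composition size_pairmap size_rcons.
rewrite -[m in LHS]subn0; apply: (@nth_block_word _ 0 N 0%N m) => //.
rewrite (path_sortedE leq_trans) all_predT /=.
rewrite -cats1 (sorted_pairwise leq_trans) pairwise_cat.
rewrite -(sorted_pairwise leq_trans) sort_sorted ?andbT /=;
  last exact: leq_total.
apply/allrelP => x y; rewrite mem_cuts inE => xC /eqP ->.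
case/orP: xC => [/((bounded x).1)/ltnW//|/andP[]//].
Qed.

Lemma composition_wordS m : (m.+1 < N)%N ->
  nth 0%N (composition_word (composition N A B)) m.+1
  = (nth 0%N (composition_word (composition N A B)) m + cut_set m.+1)%N.
Proof.
move=> mN; rewrite !composition_wordE //; last lia.
rewrite -mem_cuts addSn -count_uniq_mem; last by rewrite sort_uniq fset_uniq.
congr _.+1; rewrite -(count_predUI (fun c => c <= m)%N (pred1 m.+1)).
rewrite [X in (_ + X)%N](_ : _ = 0)%N ?addn0.
  by apply: eq_count => c /=; lia.
apply/eqP; rewrite -leqn0 leqNgt -has_count -all_predC.
by apply/allP => c _ /=; lia.
Qed.

Lemma diam_mp_network (RR : realType) net :
  {in net, forall ab : 'I_N * 'I_N, ab.2 = ab.1.+1 :> nat} ->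
  sorting_network net ->
  (diam_mp RR N A B <= count (fun ab : 'I_N * 'I_N => cut_set ab.2) net)%N.
Proof.
move=> adj sorts; rewrite /diam_mp.
pose w (j : 'I_N) := nth 0%N (composition_word (composition N A B)) j.
have -> : @multipermutohedron RR N (composition N A B) =
    convex_hull (@perm_points RR N w).
  rewrite /multipermutohedron; congr convex_hull.
  apply/seteqP; split=> _ [s _ <-]; exists s => //;
    by apply/rowP => j; rewrite !mxE.
apply: diam_network => // ab abnet.
by rewrite /w (adj _ abnet) composition_wordS // -(adj _ abnet).
Qed.

End Composition.

(** * Rotation of a direction *)

Section Gap.
Variable RR : realType.

(** Take a real between the maximum of [f] and the minimum of [g], with [-oo] or [+oo] in place of
    the extremum of an empty family. *)
Lemma ereal_gap (I : finType) (P Q : pred I) (f g : I -> \bar RR) :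
  (forall i, P i -> f i != +oo%E) -> (forall j, Q j -> g j != -oo%E) ->
  (forall i j, P i -> Q j -> (f i < g j)%E) ->
  exists a : RR, (forall i, P i -> (f i < a%:E)%E) /\
                 (forall j, Q j -> (a%:E < g j)%E).
Proof.
move=> fP gQ fg.
have [l [lP lfin lg]] : exists l, [/\ forall i, P i -> (f i <= l)%E,
    l != +oo%E & forall j, Q j -> (l < g j)%E].
  case: (pickP P) => [i0 Pi0|P0]; last first.
    exists -oo%E; split=> // [i|j Qj]; first by rewrite P0.
    by rewrite ltNye gQ.
  have [i Pi imax] := arg_maxP f Pi0.
  by exists (f i); split=> // [|j Qj]; [exact: fP|exact: fg].
have [u [uQ ufin lu]] : exists u, [/\ forall j, Q j -> (u <= g j)%E,
    u != -oo%E & (l < u)%E].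
  case: (pickP Q) => [j0 Qj0|Q0]; last first.
    exists +oo%E; split=> // [j|]; first by rewrite Q0.
    by rewrite ltey.
  have [j Qj jmin] := arg_minP g Qj0.
  by exists (g j); split=> //; [exact: gQ|exact: lg].
have [a [la au]] : exists a : RR, (l < a%:E)%E /\ (a%:E < u)%E.
  case: l u lfin ufin lu {lP lg uQ} => [l| |] [u| |] //= _ _.
  - by rewrite lte_fin => lu; exists ((l + u) / 2); rewrite !lte_fin; split;
      lra.
  - by move=> _; exists (l + 1); rewrite lte_fin ltey; split=> //; lra.
  - by move=> _; exists (u - 1); rewrite lte_fin ltNye; split=> //; lra.
  - by move=> _; exists 0; rewrite ltey ltNye.
exists a; split=> [i /lP fl|j /uQ ug]; first exact: le_lt_trans la.
exact: lt_le_trans ug.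
Qed.

End Gap.

Lemma card_pairs_lt N : #|[set ij : 'I_N * 'I_N | ij.1 < ij.2]%N| = 'C(N, 2).
Proof.
rewrite -bin2_sum big_mkord -sum1dep_card.
rewrite -(pair_big_dep xpredT (fun i j : 'I_N => i < j)%N (fun _ _ => 1%N)) /=.
rewrite (exchange_big_dep xpredT) //=; apply: eq_bigr => j _.
rewrite sum1dep_card; exact/card_ord_lt/ltnW.
Qed.

Section Slopes.
Variables (RR : realType) (N : nat) (pt : 'I_N -> RR * RR) (cut : nat -> bool).
Implicit Types (i j k p q : 'I_N) (tau : RR) (A : {set 'I_N}).

(* tau = - cot theta increases from -oo to +oo as theta goes from 0 to pi, and
   slope_height tau p = <p, u_theta^perp> / sin theta. *)
Definition slope_height tau (p : RR * RR) : RR := - (p.1 + tau * p.2).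

Let x i := (pt i).1.
Let y i := (pt i).2.
Let h tau i := slope_height tau (pt i).

(* Two points on a horizontal line may be swapped at the beginning of the
   rotation, at position m, or at its end, at position N - m. The swap is late
   exactly when this avoids a swap at a cut. *)
Definition late_tie (b : RR) : bool :=
  let m := #|[set i | b < y i]|.+1 in cut m && ~~ cut (N - m)%N.

(** Just after angle 0 the left point of a horizontal pair is the higher one. Listing it first
    postpones the swap to the end of the rotation; listing it second makes the swap due at once. *)
Definition tie_broken_order (p q : RR * RR) : bool :=
  (q.2 < p.2) || (p.2 == q.2) && (if late_tie p.2 then p.1 < q.1 else q.1 <
    p.1).

Hypothesis pt_order : forall i j, (i < j)%N -> tie_broken_order (pt i) (pt j).
Hypothesis horizontal_general : forall i j k,
  i != j -> j != k -> i != k -> y i = y j -> y j = y k -> False.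
Hypothesis slope_general : forall tau i j k,
  i != j -> j != k -> i != k -> h tau i = h tau j -> h tau j = h tau k -> False.

Definition swap_slope i j : \bar RR :=
  if y i == y j then (if late_tie (y i) then +oo else -oo)%E
  else (- ((x i - x j) / (y i - y j)))%:E.

Lemma pt_height_le i j : (i < j)%N -> y j <= y i.
Proof. by move/pt_order/orP=> [/ltW //|/andP[/eqP ye _]]; rewrite /y ye. Qed.

Lemma ne_lt i j : (i < j)%N -> i != j.
Proof. by rewrite -val_eqE /=; lia. Qed.

(** For a finite slope [s], [h tau i - h tau j = (s - tau) * (y i - y j)]. For a horizontal pair the
    sign of the difference is constant, and the tie-breaking makes it agree with the infinite
    slope. *)
Lemma swap_slopeP i j tau : (i < j)%N ->
  if (swap_slope i j < tau%:E)%E then h tau i < h tau j else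
  if (tau%:E < swap_slope i j)%E then h tau j < h tau i else
    (swap_slope i j == tau%:E) && (h tau i == h tau j).
Proof.
move=> ij; have := pt_order ij; rewrite /tie_broken_order /swap_slope.
rewrite -/(y i) -/(y j) -/(x i) -/(x j).
have hE l : h tau l = - (x l + tau * y l) by [].
have [yij|yij] /= := eqVneq (y i) (y j).
  rewrite yij ltxx /=; case: ifP => _ xij; rewrite ?ltNye ?ltey /= !hE yij; lra.
rewrite orbF => ylt; have d_gt0 : 0 < y i - y j by rewrite subr_gt0.
set s := - _; rewrite !lte_fin.
have hs : h tau i - h tau j = (s - tau) * (y i - y j).
  by rewrite !hE /s; field; rewrite subr_eq0.
case: ltgtP => st.
- by rewrite -subr_lt0 hs pmulr_llt0 // subr_lt0.
- by rewrite -subr_gt0 hs pmulr_lgt0 // subr_gt0.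
- by rewrite st eqxx -subr_eq0 hs st subrr mul0r /=.
Qed.

Lemma swap_slope_pinfty i j :
  swap_slope i j = +oo%E -> y i = y j /\ late_tie (y i).
Proof. by rewrite /swap_slope; case: eqP => // ->; case: ifP. Qed.

Lemma swap_slope_ninfty i j :
  swap_slope i j = -oo%E -> y i = y j /\ ~~ late_tie (y i).
Proof. by rewrite /swap_slope; case: eqP => // ->; case: ifP. Qed.

(** The slope of the outer pair is a weighted mean of the other two, with positive weights, and
    these differ since the points are not collinear. If an inner pair is horizontal, its slope is
    infinite and the other two fractions have the same denominator. *)
Lemma swap_slope_triple i j k : (i < j < k)%N ->
  (swap_slope i j < swap_slope i k < swap_slope j k)%E \/
  (swap_slope j k < swap_slope i k < swap_slope i j)%E.
Proof.
move=> /andP[ij jk]; have ik := ltn_trans ij jk.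
have [[nij njk] nik] := (ne_lt ij, ne_lt jk, ne_lt ik).
have hgen := @horizontal_general _ _ _ nij njk nik.
have slgen tau := @slope_general tau _ _ _ nij njk nik.
have := pt_order ij; have := pt_order jk; have := pt_order ik.
rewrite /tie_broken_order /swap_slope.
rewrite -/(y i) -/(y j) -/(y k) -/(x i) -/(x j) -/(x k).
have hE tau l : h tau l = - (x l + tau * y l) by [].
have [yik|yik] /= := eqVneq (y i) (y k).
  have := pt_height_le ij; have := pt_height_le jk => ykj yji.
  by case: hgen; lra.
rewrite orbF => yki.
have [yjk|yjk] /= := eqVneq (y j) (y k).
  have nyij : y i != y j by rewrite yjk.
  rewrite yjk ltxx (negPf yik) /= => xjk _; rewrite -yjk.
  have d0 : 0 < (y i - y j)^-1 by rewrite invr_gt0 subr_gt0 yjk.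
  move: xjk; rewrite yjk; case: ifP => _ xjk; [left|right];
    rewrite ?ltey ?ltNye ?andbT /= lte_fin ltrN2 -yjk ltr_pM2r //; lra.
rewrite orbF => ykj.
have [yij|yij] /= := eqVneq (y i) (y j).
  rewrite -yij ltxx /= => xij.
  have d0 : 0 < (y i - y k)^-1 by rewrite invr_gt0 subr_gt0.
  move: xij; case: ifP => _ xij; [right|left];
    rewrite ?ltey ?ltNye ?andbT /= lte_fin ltrN2 ltr_pM2r //; lra.
rewrite orbF => yji; rewrite !lte_fin.
set a := - ((x i - x j) / _); set b := - ((x j - x k) / _).
set c := - _.
have aE : x i + a * y i = x j + a * y j.
  by rewrite /a; field; rewrite subr_eq0.
have bE : x j + b * y j = x k + b * y k.
  by rewrite /b; field; rewrite subr_eq0.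
have cE : x i + c * y i = x k + c * y k.
  by rewrite /c; field; rewrite subr_eq0.
have neq_ab : a != b.
  by apply/eqP => ab; apply: (slgen a); rewrite !hE; congr -%R; rewrite // ab.
have c1 : (c - a) * (y i - y k) = (b - a) * (y j - y k) by nra.
have c2 : (b - c) * (y i - y k) = (b - a) * (y i - y j) by nra.
case: (ltgtP a b) neq_ab => // ab _; [left|right]; apply/andP.
- split; first by rewrite -subr_gt0 -(pmulr_lgt0 _ (_ : 0 < y i - y k)) ?c1
    ?mulr_gt0 ?subr_gt0.
  by rewrite -subr_gt0 -(pmulr_lgt0 _ (_ : 0 < y i - y k)) ?c2 ?mulr_gt0
    ?subr_gt0.
- split; first by rewrite -subr_lt0 -(pmulr_llt0 _ (_ : 0 < y i - y k)) ?c2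
    ?nmulr_rlt0 ?subr_gt0 ?subr_lt0.
  by rewrite -subr_lt0 -(pmulr_llt0 _ (_ : 0 < y i - y k)) ?c1 ?nmulr_rlt0
    ?subr_gt0 ?subr_lt0.
Qed.

(** * The swap sequence of the rotation and the separated sets *)

Definition swap_order : seq ('I_N * 'I_N) :=
  sort (relpre (fun ij => swap_slope ij.1 ij.2) <=%O)
    (enum [set ij : 'I_N * 'I_N | ij.1 < ij.2]%N).

Let e := swap_order.
Let rho i j := index (i, j) e.

Lemma swap_order_uniq : uniq e.
Proof. by rewrite sort_uniq enum_uniq. Qed.

Lemma mem_swap_order ij : (ij \in e) = (ij.1 < ij.2)%N.
Proof. by rewrite mem_sort mem_enum inE. Qed.

Lemma size_swap_order : size e = 'C(N, 2).
Proof. by rewrite size_sort -cardE card_pairs_lt. Qed.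

Lemma rho_slope i j i' j' : (i < j)%N -> (i' < j')%N ->
  (rho i j <= rho i' j')%N -> (swap_slope i j <= swap_slope i' j')%E.
Proof.
move=> ij ij'.
have tr : transitive (relpre (fun ij : 'I_N * 'I_N => swap_slope ij.1 ij.2)
  <=%O).
  by move=> a b c; exact: le_trans.
have tot : total (relpre (fun ij : 'I_N * 'I_N => swap_slope ij.1 ij.2) <=%O).
  by move=> a b; exact: le_total.
have rf : reflexive (relpre (fun ij : 'I_N * 'I_N => swap_slope ij.1 ij.2)
  <=%O).
  by move=> a; exact: lexx.
have /= := sorted_leq_index tr rf (sort_sorted tot _) (i, j) (i', j').
by apply; rewrite mem_swap_order.
Qed.

Lemma slope_rho i j i' j' : (i < j)%N -> (i' < j')%N ->
  (swap_slope i j < swap_slope i' j')%E -> (rho i j < rho i' j')%N.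
Proof.
by move=> ij ij'; apply: contraTT; rewrite -leqNgt -leNgt; exact: rho_slope.
Qed.

Lemma swap_order_triple i j k : (i < j < k)%N ->
  (rho i j < rho i k < rho j k)%N || (rho j k < rho i k < rho i j)%N.
Proof.
move=> ijk; have /andP[ij jk] := ijk; have ik := ltn_trans ij jk.
by apply/orP; case: (swap_slope_triple ijk) => /andP[/slope_rho h1 /slope_rho
  h2];
  [left|right]; rewrite h1 // h2.
Qed.

Let eu := swap_order_uniq.
Let em := mem_swap_order.
Let et := swap_order_triple.

Definition dominates (f : 'I_N -> RR) A :=
  forall i j, i \in A -> j \notin A -> f j < f i.

(** The first case is the angle 0, the limit [tau = -oo]; the second covers the angles strictly
    between 0 and pi. The angle pi is excluded, as for [direction_angle]. *)
Definition slope_separated A :=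
  dominates y A \/ exists tau, dominates (h tau) A.

(** A value [tau] corresponds to the time [t] before which exactly the pairs of slope less than
    [tau] are swapped. A pair of slope [tau] has equal heights, so [A] cannot split it. *)
Lemma separated_top A (k : nat) : #|A| = k -> (k <= N)%N -> slope_separated A ->
  A \in all_tops e k.
Proof.
move=> Ak kN; rewrite /all_tops => -[yA|[tau hA]].
  apply/topsP; exists 0%N; rewrite ?ltnS //.
  apply: (eq_top eu et kN Ak) => i j iA jA; rewrite /above /=.
  rewrite andbT; case: ltngtP => // [/pt_height_le yij|/val_inj ij].
    by have := yA i j iA jA; rewrite ltNge yij.
  by rewrite -ij iA in jA.
have [t te tP] : exists2 t, (t <= size e)%N &
    forall i j, (i < j)%N -> (rho i j < t)%N = (swap_slope i j < tau%:E)%E.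
  pose Q := [pred ij : 'I_N * 'I_N |
    (ij.1 < ij.2)%N && (tau%:E <= swap_slope ij.1 ij.2)%E].
  case: (pickP Q) => [ij0 Q0|Q0]; last first.
    exists (size e) => // i j ij; rewrite (rho_lt em ij).
    by have := Q0 (i, j); rewrite /= ij /= leNgt => /negbFE ->.
  have [[i0 j0] /andP[/= lt0 le0] min0] := arg_minnP (fun ij => rho ij.1 ij.2)
    Q0.
  exists (rho i0 j0) => [|i j ij]; first exact/ltnW/(rho_lt em).
  apply/idP/idP => [lt_rho|lt_tau].
    rewrite ltNge; apply/negP => tau_le.
    have := min0 (i, j); rewrite /= ij tau_le leqNgt lt_rho => /(_ isT) //.
  exact/slope_rho/(lt_le_trans lt_tau le0).
apply/topsP; exists t; rewrite ?ltnS //.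
apply: (eq_top eu et kN Ak) => i j iA jA;
  rewrite /above -/(rho i j) -/(rho j i).
have hij := hA i j iA jA.
case: ltngtP => /= [ij|ji|/val_inj ij]; last by rewrite -ij iA in jA.
  rewrite orbF leqNgt tP //; have := swap_slopeP tau ij.
  by case: ifP => // _ hij'; have := lt_trans hij hij'; rewrite ltxx.
rewrite tP //; have := swap_slopeP tau ji; case: ifP => // _; case: ifP => _.
  by move=> hij'; have := lt_trans hij hij'; rewrite ltxx.
by case/andP => _ /eqP hh; rewrite hh ltxx in hij.
Qed.

(* The four values agree by the monotonicity of f across A, so two distinct
   pairs would give three points on a level line of f. *)
Lemma crossing_unique (f : 'I_N -> RR) A p q p' q' :
  p \in A -> q \notin A -> p' \in A -> q' \notin A ->
  f p = f q -> f p' = f q' ->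
  (forall i j k, i != j -> j != k -> i != k -> f i = f j -> f j = f k -> False)
    ->
  (forall a b, a \in A -> b \notin A -> f b <= f a) -> p = p' /\ q = q'.
Proof.
move=> pA qA p'A q'A pq pq' f_general f_dom.
have h1 := f_dom _ _ pA q'A; have h2 := f_dom _ _ p'A qA.
have neq a b : a \in A -> b \notin A -> a != b.
  by move=> aA; apply: contraNneq => <-.
have npq := neq _ _ pA qA; have npq' := neq _ _ pA q'A.
have np'q := neq _ _ p'A qA.
have [pp'|npp'] := eqVneq p p'; last first.
  by case: (f_general p p' q); rewrite //; lra.
have [qq'|nqq'] := eqVneq q q'; first by [].
by case: (f_general p q q'); rewrite //; lra.
Qed.

(** Thus [late_tie] computes the position [i + 1] for this pair: no third point has the same
    height. *)
Lemma card_higher i j : (j = i.+1 :> nat)%N -> y i = y j ->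
  #|[set l | y i < y l]| = i.
Proof.
move=> ji yij; rewrite -[RHS](card_ord_lt (ltnW (ltn_ord i))).
have ij : (i < j)%N by lia.
apply: eq_card => l; rewrite !inE; apply/idP/idP => [|li].
  by apply: contraTT; rewrite -leqNgt -leNgt leq_eqVlt =>
    /orP[/eqP/val_inj->//|];
    exact: pt_height_le.
rewrite lt_neqAle (pt_height_le li) andbT; apply/eqP => yil.
by case: (@horizontal_general l i j); rewrite ?ne_lt // (ltn_trans li).
Qed.

Lemma tie_adjacent i j : (i < j)%N -> y i = y j -> j = i.+1 :> nat.
Proof.
move=> ij yij; apply/eqP; rewrite eqn_leq ij andbT leqNgt; apply/negP => ilj.
have lN : (i.+1 < N)%N by apply: ltn_trans ilj _.
pose l : 'I_N := Ordinal lN.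
have il : (i < l)%N by rewrite /=.
have lj : (l < j)%N by rewrite /=.
case: (@horizontal_general i l j); rewrite ?ne_lt //.
  by have := pt_height_le il; have := pt_height_le lj; lra.
by have := pt_height_le il; have := pt_height_le lj; lra.
Qed.

(* The second case is that of a pair on a horizontal line which is still to be
   swapped at the beginning of the rotation, at position k. *)
Lemma top_separated (k t : nat) : (k <= N)%N -> (t <= size e)%N -> cut k ->
  (exists tau, dominates (h tau) (top e t k)) \/
  [/\ cut (N - k)%N, top e t k = top e 0 k & (t < size e)%N].
Proof.
move=> kN te ck; set A := top e t k.
have cross p q : p \in A -> q \notin A -> above e t p q.
  exact: (above_top eu et).
have neq p q : p \in A -> q \notin A -> p != q.
  by move=> pA; apply: contraNneq => <-.
have Ak : #|A| = k by exact: (card_top eu et).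
(* The pairs split by [A] are swapped before [t] or still in their initial order. The aim is a [tau]
   above all slopes of the first class and below all slopes of the second. *)
pose swapped := [pred pq : 'I_N * 'I_N |
  [&& pq.1 \in A, pq.2 \notin A & (pq.2 < pq.1)%N]].
pose kept := [pred pq : 'I_N * 'I_N |
  [&& pq.1 \in A, pq.2 \notin A & (pq.1 < pq.2)%N]].
have swapped_rho p q : swapped (p, q) -> (rho q p < t)%N.
  by case/and3P => /= pA qA qp; have := cross p q pA qA;
    rewrite /above -/(rho q p); lia.
have kept_rho p q : kept (p, q) -> (t <= rho p q)%N.
  by case/and3P => /= pA qA pq; have := cross p q pA qA;
    rewrite /above -/(rho p q); lia.
have swapped_kept p q p' q' : swapped (p, q) -> kept (p', q') ->
    (swap_slope q p <= swap_slope p' q')%E.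
  move=> s k'; have := swapped_rho _ _ s; have := kept_rho _ _ k'.
  case/and3P: s => _ _ qp; case/and3P: k' => _ _ pq' t1 t2.
  by apply: rho_slope => //; exact: ltnW (leq_trans t2 t1).
have swapped_or_kept p q : p \in A -> q \notin A -> swapped (p, q) || kept (p,
  q).
  move=> pA qA; rewrite /= pA qA /=; have := neq p q pA qA.
  by rewrite -val_eqE /=; lia.
(* If a swapped pair has slope [+oo], a kept one would be a second horizontal pair split by [A]; so
   all are swapped and [A] is the final top. The position in [late_tie] is then [N - k], where a
   late tie contradicts [cut k]. *)
have [/existsP[[p q] /andP[sw /eqP Tinf]]|no_inf] :=
    boolP [exists pq, swapped pq && (swap_slope pq.2 pq.1 == +oo%E)].
  have [yqp late] := swap_slope_pinfty Tinf; move: Tinf late => /= Tinf late.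
  have all_swapped p' q' : p' \in A -> q' \notin A -> swapped (p', q').
    move=> p'A q'A; case/orP: (swapped_or_kept p' q' p'A q'A) => // kp.
    have := swapped_kept _ _ _ _ sw kp; rewrite Tinf leye_eq => /eqP.
    case/swap_slope_pinfty => ypq' _.
    have [pA qA qp] := and3P sw; have [_ _ pq'] := and3P kp.
    have [||||E1 E2] := @crossing_unique (fun i => - y i) A p q p' q' pA qA p'A
      q'A.
    - by rewrite yqp.
    - by rewrite ypq'.
    - move=> i j l ij jl il /oppr_inj yij /oppr_inj yjl.
      exact: (horizontal_general ij jl il).
    - move=> a b aA bA; rewrite lerN2.
      case/orP: (swapped_or_kept a b aA bA) => [/and3P[_ _ /pt_height_le]
        //|kab].
      have := swapped_kept _ _ _ _ sw kab; rewrite Tinf leye_eq => /eqP.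
      by case/swap_slope_pinfty => ->.
    by move: qp pq'; rewrite /= E1 E2; lia.
  have Aend : A = top e (size e) k.
    apply: (eq_top eu et kN Ak) => p' q' p'A q'A.
    have /and3P[_ _ /= lt] := all_swapped _ _ p'A q'A.
    by rewrite /above lt (rho_lt em lt) orbT.
  have /and3P[/= pA /= qA /= qp] := sw.
  have pq1 := tie_adjacent qp yqp.
  move: pA qA; rewrite Aend (top_end eu em) !inE => pA qA.
  have qE : (q.+1 = N - k)%N by have := ltn_ord p; lia.
  move: late; rewrite /late_tie (card_higher pq1 yqp) qE subKn // ck.
  by rewrite andbF.
(* Symmetrically, a kept pair of slope [-oo] makes [A] the initial top, and a tie at position [k]
   that is not late, together with [cut k], gives [cut (N - k)]. *)
have [/existsP[[p q] /andP[kp /eqP Tinf]]|no_ninf] :=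
    boolP [exists pq, kept pq && (swap_slope pq.1 pq.2 == -oo%E)].
  have [yqp late] := swap_slope_ninfty Tinf; move: Tinf late => /= Tinf late.
  have all_kept p' q' : p' \in A -> q' \notin A -> kept (p', q').
    move=> p'A q'A; case/orP: (swapped_or_kept p' q' p'A q'A) => // sw.
    have := swapped_kept _ _ _ _ sw kp; rewrite Tinf leeNy_eq => /eqP.
    case/swap_slope_ninfty => ypq' _.
    have [pA qA pq] := and3P kp; have [_ _ pq'] := and3P sw.
    have [||||E1 E2] := @crossing_unique y A p q p' q' pA qA p'A q'A.
    - by rewrite yqp.
    - by rewrite ypq'.
    - exact: horizontal_general.
    - move=> a b aA bA.
      case/orP: (swapped_or_kept a b aA bA) => [sab|/and3P[_ _ /pt_height_le]
        //].
      have := swapped_kept _ _ _ _ sab kp; rewrite Tinf leeNy_eq => /eqP.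
      by case/swap_slope_ninfty => ->.
    by move: pq pq'; rewrite /= E1 E2; lia.
  right; have /and3P[/= pA /= qA /= pq] := kp.
  have A0 : A = top e 0 k.
    apply: (eq_top eu et kN Ak) => p' q' p'A q'A.
    by have /and3P[_ _ /= lt] := all_kept _ _ p'A q'A; rewrite /above lt.
  split=> //; last exact: leq_ltn_trans (kept_rho _ _ kp) (rho_lt em pq).
  have pq1 := tie_adjacent pq yqp.
  move: pA qA; rewrite A0 (top0 eu) !inE => pA qA.
  have pE : (p.+1 = k)%N by lia.
  by move: late; rewrite /late_tie (card_higher pq1 yqp) pE ck /= negbK.
(* Equality would occur at a finite [tau], with equal heights in both pairs. Then [crossing_unique]
   identifies the pairs, although one is inverted and the other is not. *)
have slope_sep p q p' q' : swapped (p, q) -> kept (p', q') ->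
    (swap_slope q p < swap_slope p' q')%E.
  move=> sw kp; rewrite lt_neqAle (swapped_kept _ _ _ _ sw kp) andbT.
  apply/eqP => TT.
  have [tau T1] : exists tau, swap_slope q p = tau%:E.
    move/existsPn/(_ (p, q)): no_inf; move/existsPn/(_ (p', q')): no_ninf.
    rewrite /= in sw kp *; rewrite sw kp -TT /=.
    by case: (swap_slope q p) => // r; exists r.
  have T2 : swap_slope p' q' = tau%:E by rewrite -TT.
  have [pA qA qp] := and3P sw; have [p'A q'A pq'] := and3P kp.
  have heq (a b : 'I_N) : (a < b)%N -> swap_slope a b = tau%:E -> h tau a = h
    tau b.
    move=> ab Tab; have := swap_slopeP tau ab.
    by rewrite Tab ltxx => /andP[_ /eqP].
  have [||||E1 E2] := @crossing_unique (h tau) A p q p' q' pA qA p'A q'A.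
  - by rewrite (heq _ _ qp T1).
  - by rewrite (heq _ _ pq' T2).
  - exact: slope_general.
  - move=> a b aA bA; case/orP: (swapped_or_kept a b aA bA) => [sab|kab].
      have := swapped_kept _ _ _ _ sab kp; rewrite T2.
      have /and3P[_ _ ba] := sab; have := swap_slopeP tau ba.
      case: ifP => [_ /ltW //|_]; case: ifP => [lt _|_ /andP[_ /eqP ->] //].
      by rewrite leNgt lt.
    have := swapped_kept _ _ _ _ sw kab; rewrite T1.
    have /and3P[_ _ ab] := kab; have := swap_slopeP tau ab.
    case: ifP => [lt _|_]; first by rewrite leNgt lt.
    by case: ifP => [_ /ltW //|_ /andP[_ /eqP ->]].
  by move: qp pq'; rewrite /= E1 E2; lia.
left.
have [|||tau [tau1 tau2]] := @ereal_gap _ _ swapped kept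
    (fun pq => swap_slope pq.2 pq.1) (fun pq => swap_slope pq.1 pq.2).
- by move=> pq sw; move/existsPn/(_ pq): no_inf; rewrite sw.
- by move=> pq kp; move/existsPn/(_ pq): no_ninf; rewrite kp.
- by move=> [p q] [p' q']; exact: slope_sep.
exists tau => p q pA qA; case/orP: (swapped_or_kept p q pA qA) => [sw|kp].
  have := tau1 _ sw; have /and3P[_ _ /= qp] := sw.
  by have := swap_slopeP tau qp => /[swap] ->.
have := tau2 _ kp; have /and3P[_ _ /= pq] := kp.
have := swap_slopeP tau pq; case: ifP => [lt _ lt'|_].
  by have := lt_trans lt lt'; rewrite ltxx.
by move=> /[swap] ->.
Qed.

Lemma all_tops_separated (k : nat) A : (k <= N)%N -> cut k -> A \in all_tops e
  k ->
  (exists tau, dominates (h tau) A) \/ cut (N - k)%N /\ A = top e 0 k.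
Proof.
move=> kN ck /topsP[t te ->]; rewrite ltnS in te.
by have [|[cNk A0 _]] := top_separated kN te ck; [left|right].
Qed.

Lemma top_end_separated (k : nat) : (k <= N)%N -> cut k ->
  exists tau, dominates (h tau) (top e (size e) k).
Proof.
move=> kN ck; have [//|[_ _]] := top_separated kN (leqnn _) ck.
by rewrite ltnn.
Qed.

Lemma mem_all_bottoms (k : nat) A : (A \in all_bottoms e k) = (~: A \in
  all_tops e (N - k)).
Proof.
apply/imsetP/idP => [[B Btop ->]|Atop]; first by rewrite finset.setCK.
by exists (~: A); rewrite ?finset.setCK.
Qed.

Lemma card_setC_ord (k : nat) A : (k <= N)%N -> (#|~: A| == (N - k)%N) = (#|A|
  == k).
Proof. by move=> kN; have := cardsC A; rewrite card_ord; lia. Qed.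

Lemma separated_tops (k : nat) : (k <= N)%N -> cut k -> ~~ cut (N - k)%N ->
  [set A : {set 'I_N} | (#|A| == k) && `[< slope_separated A >]] = all_tops e k.
Proof.
move=> kN ck nck; apply/setP => A; rewrite finset.in_set; apply/andP/idP.
  by case=> /eqP Ak /asboolP; exact: separated_top.
move=> Atop; split; first by case/topsP: Atop => t _ ->;
  rewrite (card_top eu et).
apply/asboolP; have [sep|[cNk]] := all_tops_separated kN ck Atop;
  first by right.
by rewrite cNk in nck.
Qed.

Lemma separated_bottoms (k : nat) : (k <= N)%N -> ~~ cut k -> cut (N - k)%N ->
  [set A : {set 'I_N} | (#|A| == k) && `[< slope_separated (~: A) >]]
  = all_bottoms e k.
Proof.
move=> kN nck cNk; apply/setP => A; rewrite mem_all_bottoms.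
have nck' : ~~ cut (N - (N - k))%N by rewrite subKn.
rewrite -(separated_tops (leq_subr k N) cNk nck') !finset.in_set.
by rewrite card_setC_ord.
Qed.

(** A top that is not separated is the initial one. Its complement is the final top of size [N - k],
    which is separated because [N - k] is a cut, so the set still counts from the other side.
    Bottoms are treated dually. *)
Lemma separated_tops_bottoms (k : nat) : (k <= N)%N -> cut k -> cut (N - k)%N ->
  [set A : {set 'I_N} |
    (#|A| == k) && `[< slope_separated A \/ slope_separated (~: A) >]]
  = all_tops e k :|: all_bottoms e k.
Proof.
move=> kN ck cNk; apply/setP => A;
  rewrite finset.in_set finset.in_setU mem_all_bottoms.
have NkN := leq_subr k N; apply/andP/orP.
  case=> Ak /asboolP[sepA|sepA]; [left|right].
    by apply: separated_top => //; exact/eqP.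
  by apply: separated_top => //; apply/eqP; rewrite card_setC_ord.
case=> Atop; split.
- by case/topsP: Atop => t _ ->; rewrite (card_top eu et).
- apply/asboolP; have [sep|[_ A0]] := all_tops_separated kN ck Atop.
    by left; right.
  right; right; rewrite A0 -(topC_end eu em kN) finset.setCK.
  exact: top_end_separated.
- by rewrite -card_setC_ord //; case/topsP: Atop => t _ ->;
    rewrite (card_top eu et).
- apply/asboolP; have [sep|[_ A0]] := all_tops_separated NkN cNk Atop.
    by right; right.
  left; right; rewrite -[A]finset.setCK A0 (topC0 eu em kN).
  exact: top_end_separated.
Qed.

End Slopes.

(** * Counting k-sets *)

Section Side.
Variable RR : realType.
Implicit Types (p : RR * RR) (theta tau : RR).

Lemma side0 p0 p : side p0 0 p = p.2 - p0.2.
Proof. by rewrite /side sin0 cos0; ring. Qed.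

Lemma direction_angle0 : direction_angle (0 : RR).
Proof. by rewrite /direction_angle lexx pi_gt0. Qed.

Lemma side_slope theta : direction_angle theta -> theta = 0 \/
  exists tau c, 0 < c /\ forall p0 p,
    side p0 theta p = c * (slope_height tau p - slope_height tau p0).
Proof.
move=> /andP[]; rewrite le_eqVlt => /predU1P[->|t0 tpi]; first by left.
have s0 : 0 < sin theta by rewrite sin_gt0_pi // t0.
right; exists (- (cos theta / sin theta)), (sin theta); split=> // p0 p.
by rewrite /side /slope_height; field; rewrite gt_eqF.
Qed.

Lemma slope_side tau : exists theta c, [/\ direction_angle theta, 0 < c &
  forall p0 p,
    side p0 theta p = c * (slope_height tau p - slope_height tau p0)].
Proof.
have c0 : 0 < cos (atan tau) by rewrite cos_gt0_pihalf // atan_gtNpi2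
  atan_ltpi2.
(* This angle solves [tau = - cot theta], and the factor [c] is its sine. *)
exists (atan tau + pi / 2), (cos (atan tau)); split=> // [|p0 p].
  have := atan_gtNpi2 tau; have := atan_ltpi2 tau.
  by rewrite /direction_angle => h1 h2; apply/andP; split; lra.
rewrite /side sinDpihalf cosDpihalf /slope_height.
have -> : sin (atan tau) = tau * cos (atan tau).
  by rewrite -[X in X * _](atanK tau) /tan mulfVK // gt_eqF.
by ring.
Qed.

End Side.

Section Transfer.
Variables (RR : realType) (N : nat) (pt : 'I_N -> RR * RR) (X : {fset RR * RR}).
Implicit Types (A : {set 'I_N}) (p : RR * RR).
Hypothesis pt_inj : injective pt.
Hypothesis ptX : forall p, reflect (exists i, p = pt i) (p \in X).

Definition pts A : {fset RR * RR} := [fset pt i | i in A]%fset.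

Lemma pt_pts i A : (pt i \in pts A) = (i \in A).
Proof. by rewrite mem_imfset. Qed.

Lemma pts_sub A : (pts A `<=` X)%fset.
Proof.
by apply/fsubsetP => _ /imfsetP[i _ ->]; apply/ptX; exists i.
Qed.

Lemma card_pts A : #|` pts A|%fset = #|A|.
Proof. by rewrite card_imfset //= -cardE. Qed.

Lemma pts_inj : injective pts.
Proof.
by move=> A B AB; apply/setP => i; rewrite -!pt_pts AB.
Qed.

Lemma pts_surj (S : {fset RR * RR}) : (S `<=` X)%fset -> exists A, S = pts A.
Proof.
move=> /fsubsetP SX; exists [set i | pt i \in S]; apply/fsetP => p.
apply/idP/imfsetP => [pS|[i]]; last by rewrite inE => pS ->.
by have /ptX[i pi] := SX p pS; exists i; rewrite //= inE -pi.
Qed.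

Lemma card_fpowerset_pts (P : {fset RR * RR} -> Prop) :
  #|` [fset S in fpowerset X | `[< P S >]]|%fset =
  #|[set A | `[< P (pts A) >]]|.
Proof.
have -> : [fset S in fpowerset X | `[< P S >]]%fset =
    [fset pts A | A in [set A | `[< P (pts A) >]]]%fset.
  apply/fsetP => S; apply/idP/imfsetP => /=.
    rewrite !inE /= fpowersetE => /andP[/pts_surj[A ->] PA].
    by exists A; first rewrite finset.in_set.
  by move=> [A]; rewrite finset.in_set => PA ->;
    rewrite !inE /= fpowersetE pts_sub.
by rewrite card_imfset //= -?cardE //; exact: pts_inj.
Qed.

Lemma threshold (f : 'I_N -> RR) A : dominates f A ->
  exists a, (forall i, i \in A -> a < f i) /\ (forall j, j \notin A -> f j < a).
Proof.
move=> domA.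
have [|||a [a1 a2]] := @ereal_gap RR _ [pred j | j \notin A] [pred i | i \in A]
  (fun i => (f i)%:E) (fun i => (f i)%:E) => //.
  by move=> j i /= jA iA; rewrite lte_fin domA.
by exists a; split=> i iA; rewrite -lte_fin; [exact: a2|exact: a1].
Qed.

Let notin_pts j A : j \notin A -> pt j \in (X `\` pts A)%fset.
Proof. by move=> jA; rewrite inE pt_pts jA /=; apply/ptX; exists j. Qed.

Lemma separated_side A : slope_separated pt A <-> exists p0 theta,
  [/\ direction_angle theta, forall p, p \in pts A -> 0 < side p0 theta p &
    forall p, p \in (X `\` pts A)%fset -> side p0 theta p < 0].
Proof.
split.
  case=> [|[tau]] /threshold[a [aA aNA]].
    exists (0, a), 0; split; first exact: direction_angle0.
      by move=> _ /imfsetP[i /= iA ->]; rewrite side0 subr_gt0 aA.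
    move=> p /fsetDP[/ptX[i ->]]; rewrite pt_pts => iA.
    by rewrite side0 subr_lt0 aNA.
  have [theta [c [dir c0 sideE]]] := slope_side tau.
  have hE : slope_height tau (- a, 0) = a.
    by rewrite /slope_height /= mulr0 addr0 opprK.
  exists (- a, 0), theta; split=> //.
    by move=> _ /imfsetP[i /= iA ->];
      rewrite sideE hE pmulr_rgt0 // subr_gt0 aA.
  move=> p /fsetDP[/ptX[i ->]]; rewrite pt_pts => iA.
  by rewrite sideE hE pmulr_rlt0 // subr_lt0 aNA.
move=> [p0 [theta [dir inA notinA]]].
have dom i j : i \in A -> j \notin A ->
    side p0 theta (pt j) < side p0 theta (pt i).
  move=> iA jA; apply: lt_trans (inA _ _); last by rewrite pt_pts.
  exact/notinA/notin_pts.
have [t0|[tau [c [c0 sideE]]]] := side_slope dir; [left|right; exists tau];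
    move=> i j iA jA; have := dom i j iA jA.
  by rewrite t0 !side0 ltrD2r.
by rewrite !sideE ltr_pM2l // ltrD2r.
Qed.

Lemma separatedC_side A : slope_separated pt (~: A) <-> exists p0 theta,
  [/\ direction_angle theta, forall p, p \in pts A -> side p0 theta p < 0 &
    forall p, p \in (X `\` pts A)%fset -> 0 < side p0 theta p].
Proof.
have ptsC p : (p \in (X `\` pts A)%fset) = (p \in pts (~: A)).
  apply/fsetDP/imfsetP => /= [[/ptX[i ->]]|[i]].
    by rewrite pt_pts => iA; exists i; rewrite ?inE.
  by rewrite inE => iA ->; rewrite pt_pts; split=> //; apply/ptX; exists i.
have ptsCC p : (p \in (X `\` pts (~: A))%fset) = (p \in pts A).
  rewrite in_fsetD -ptsC in_fsetD negb_and negbK.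
  have [pA|_] /= := boolP (p \in pts A); last exact: andNb.
  exact: fsubsetP (pts_sub A) p pA.
rewrite separated_side; split=> -[p0 [theta [dir h1 h2]]]; exists p0, theta.
  by split=> // p; [rewrite -ptsCC; exact: h2|rewrite ptsC; exact: h1].
by split=> // p; [rewrite -ptsC; exact: h2|rewrite ptsCC; exact: h1].
Qed.

Lemma left_ksetE k A :
  left_kset k X (pts A) <-> #|A| = k /\ slope_separated pt A.
Proof.
rewrite separated_side /left_kset card_pts.
by split=> [[_ Ak sep]|[Ak sep]]; split=> //; exact: pts_sub.
Qed.

Lemma right_ksetE k A :
  right_kset k X (pts A) <-> #|A| = k /\ slope_separated pt (~: A).
Proof.
rewrite separatedC_side /right_kset card_pts.
by split=> [[_ Ak sep]|[Ak sep]]; split=> //; exact: pts_sub.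
Qed.

Lemma num_left_ksetsE k : num_left_ksets k X =
  #|[set A : {set 'I_N} | (#|A| == k) && `[< slope_separated pt A >]]|.
Proof.
rewrite /num_left_ksets card_fpowerset_pts; apply: eq_card => A.
rewrite !finset.in_set;
  apply/asboolP/andP => [/left_ksetE[-> ?]|[/eqP ? /asboolP ?]].
  by split=> //; exact/asboolP.
exact/left_ksetE.
Qed.

Lemma num_right_ksetsE k : num_right_ksets k X =
  #|[set A : {set 'I_N} | (#|A| == k) && `[< slope_separated pt (~: A) >]]|.
Proof.
rewrite /num_right_ksets card_fpowerset_pts; apply: eq_card => A.
rewrite !finset.in_set;
  apply/asboolP/andP => [/right_ksetE[-> ?]|[/eqP ? /asboolP ?]].
  by split=> //; exact/asboolP.
exact/right_ksetE.
Qed.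

Lemma num_ksetsE k : num_ksets k X =
  #|[set A : {set 'I_N} |
    (#|A| == k) && `[< slope_separated pt A \/ slope_separated pt (~: A) >]]|.
Proof.
rewrite /num_ksets card_fpowerset_pts; apply: eq_card => A.
rewrite !finset.in_set; apply/asboolP/andP.
  by case=> [/left_ksetE|/right_ksetE] [-> ?]; split=> //; apply/asboolP;
    [left|right].
by case=> /eqP Ak /asboolP[sep|sep]; [left; exact/left_ksetE|right;
  exact/right_ksetE].
Qed.

End Transfer.

Section Enumeration.
Variables (RR : realType) (N : nat) (cut : nat -> bool).

Lemma card_nth_count (T : Type) (x0 : T) (s : seq T) (P : pred T) :
  size s = N -> #|[set i : 'I_N | P (nth x0 s i)]| = count P s.
Proof.
by move=> sN; rewrite -sum1dep_card -sum1_count (big_nth x0) big_mkord sN.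
Qed.

(** The tie-breaking refers to the enumeration that it serves to define. There is no circle:
    [late_tie] only counts the points above a height, so the arbitrary enumeration [pt0] gives the
    same answer. *)
Lemma tie_broken_enumeration (X : {fset RR * RR}) : #|` X|%fset = N ->
  exists pt : 'I_N -> RR * RR, [/\ injective pt,
    forall p, p \in X <-> exists i, p = pt i &
    forall i j : 'I_N, (i < j)%N -> tie_broken_order pt cut (pt i) (pt j)].
Proof.
move=> card_X; pose pt0 (i : 'I_N) : RR * RR := nth 0 X i.
pose late := late_tie pt0 cut.
pose le (p q : RR * RR) := (q.2 < p.2) ||
  (q.2 == p.2) && (if late p.2 then p.1 <= q.1 else q.1 <= p.1).
have le_tot : total le.
  move=> [a b] [c d]; rewrite /le /=; case: ltgtP => //= ->.
  by case: ifP => _; exact: le_total.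
have le_tr : transitive le.
  move=> [c d] [a b] [a' b'] /orP[/= bd|/andP[/= /eqP <- ac]]
    /orP[/= db|/andP[/= /eqP -> ca]]; rewrite /le /=.
  - by rewrite (lt_trans db bd).
  - by rewrite bd.
  - by rewrite db.
  rewrite eqxx orbC; case: ifP ac ca => _ ac ca.
    by rewrite (le_trans ac ca).
  by rewrite (le_trans ca ac).
pose s := sort le X.
have size_s : size s = N by rewrite size_sort.
have uniq_s : uniq s by rewrite sort_uniq fset_uniq.
pose pt (i : 'I_N) := nth 0 s i.
have pt_inj : injective pt.
  move=> i j /eqP; rewrite nth_uniq ?size_s // => /eqP; exact: val_inj.
have lateE b : late_tie pt cut b = late b.
  rewrite /late /late_tie (card_nth_count 0 (fun p => b < p.2) size_s).
  rewrite (card_nth_count 0 (fun p => b < p.2) card_X).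
  by rewrite (seq.permP (permEl (perm_sort le X))).
exists pt; split=> // [p|i j ij].
  rewrite -(mem_sort le) -/s; split=> [/(nthP 0)[i]|[i ->]].
    by rewrite size_s => iN <-; exists (Ordinal iN).
  by rewrite mem_nth ?size_s.
have : le (pt i) (pt j).
  by apply: (sorted_ltn_nth le_tr) => //; rewrite ?inE ?size_s ?sort_sorted.
have neq_pt : pt i != pt j by rewrite (inj_eq pt_inj) -val_eqE /=; lia.
rewrite /le /tie_broken_order lateE.
case: (pt i) (pt j) neq_pt => [a b] [c d]; rewrite xpair_eqE /=.
have [->|_] := eqVneq d b; last by rewrite !andFb !orbF.
rewrite ltxx ?eqxx ?andbT /= => ac; case: ifP => _; rewrite lt_neqAle.
  by rewrite ac.
by rewrite eq_sym ac.
Qed.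

End Enumeration.

(** * Cuts and the swaps at them *)

Section CutCount.
Variables (N : nat) (L R : {fset nat}).
Hypothesis L_sub : (L `<=` interval1 (N.-1)./2)%fset.
Hypothesis R_sub : (R `<=` interval1 (N.-1)./2)%fset.

Let mem_L k : k \in L -> (0 < k <= (N.-1)./2)%N.
Proof. by move/(fsubsetP L_sub); rewrite in_fset mem_iota; lia. Qed.

Let mem_R k : k \in R -> (0 < k <= (N.-1)./2)%N.
Proof. by move/(fsubsetP R_sub); rewrite in_fset mem_iota; lia. Qed.

Lemma cut_set_low k : (k <= (N.-1)./2)%N -> cut_set N L R k = (k \in L).
Proof.
move=> kN; rewrite /cut_set; case: (k \in L) => //=.
have [->|k0] := posnP k; last by apply/negP => /andP[_ /mem_R]; lia.
by rewrite subn0; apply/negP => /mem_R; lia.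
Qed.

Lemma cut_set_high k : (0 < k)%N -> (k <= (N.-1)./2)%N ->
  cut_set N L R (N - k)%N = (k \in R).
Proof.
move=> k0 kN; rewrite /cut_set subKn ?leq_subr; last lia.
by case: (boolP (_ \in L)) => // /mem_L; lia.
Qed.

(** For [0 < c < N] exactly one of [c <= N./2] and [N - c <= (N.-1)./2] holds, so each position is
    governed by one of the two sets. *)
Lemma cut_set_compl c : (0 < c < N)%N ->
  cut_set N (interval1 N./2 `\` L)%fset (interval1 (N.-1)./2 `\` R)%fset c
  = ~~ cut_set N L R c.
Proof.
move=> cN; rewrite /cut_set !in_fsetD !in_fset !mem_iota.
case: (boolP (c \in L)) => [/mem_L|] cL;
  case: (boolP (_ \in R)) => [/mem_R|] cR; lia.
Qed.

Lemma count_mem_fset (T : Type) (f : T -> nat) (S : {fset nat}) (s : seq T) :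
  count (fun a => f a \in S) s
  = (\sum_(k <- S) count (fun a => f a == k) s)%N.
Proof.
elim: s => [|a s IH] /=; first by rewrite big1.
rewrite IH big_split /=; congr (_ + _)%N.
rewrite -(count_uniq_mem _ (fset_uniq S)) -sum1_count big_mkcond /=.
by apply: eq_bigr => k _; rewrite eq_sym; case: eqP.
Qed.

Lemma count_cut_set (net : seq ('I_N * 'I_N)) :
  count (fun ab : 'I_N * 'I_N => cut_set N L R ab.2) net =
  (\sum_(k <- L) swaps_at k net + \sum_(k <- R) swaps_at (N - k) net)%N.
Proof.
rewrite -(count_mem_fset (fun ab : 'I_N * 'I_N => val ab.2)).
have -> : (\sum_(k <- R) swaps_at (N - k) net)%N =
    (\sum_(k <- R)
      count (fun ab : 'I_N * 'I_N => (N - ab.2)%N == k) net)%N.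
  rewrite !big_seq; apply: eq_bigr => k /mem_R kN; apply: eq_count => ab.
  by have := ltn_ord ab.2; rewrite /=; lia.
rewrite -(count_mem_fset (fun ab : 'I_N * 'I_N => N - ab.2)%N).
rewrite -count_predUI [X in (_ + X)%N](_ : _ = 0)%N ?addn0.
  by apply: eq_count => ab; rewrite /cut_set /= (ltnW (ltn_ord _)).
apply/eqP; rewrite -leqn0 leqNgt -has_count; apply/hasPn => ab _ /=.
by apply/negP => /andP[/mem_L + /mem_R]; lia.
Qed.

Lemma sum_fsetID (F : nat -> nat) (S T : {fset nat}) :
  (\sum_(k <- S) F k =
   \sum_(k <- (S `&` T)%fset) F k + \sum_(k <- (S `\` T)%fset) F k)%N.
Proof.
rewrite (big_fsetID _ (mem T)) /=; congr (_ + _)%N; apply: eq_fbigl => k;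
  by rewrite !inE /= ?andbT // andbC.
Qed.

End CutCount.

Section KsetNetwork.
Variables (RR : realType) (N : nat) (X : {fset RR * RR}).
Hypothesis card_X : #|` X|%fset = N.
Hypothesis gen_X : general_position X.
Variables (L R : {fset nat}).
Hypothesis L_sub : (L `<=` interval1 (N.-1)./2)%fset.
Hypothesis R_sub : (R `<=` interval1 (N.-1)./2)%fset.

(** For [k] in both sets, the tops and bottoms have two sets in common and their union has as many
    elements as there are swaps at [k] and [N - k]. For [k] in one set only, there is one set more
    than swaps, whence the two cardinals. *)
Lemma kset_network : exists net : seq ('I_N * 'I_N), [/\
  {in net, forall ab : 'I_N * 'I_N, ab.2 = ab.1.+1 :> nat},
  sorting_network net, size net = 'C(N, 2) &
  (num_LRsets L R X =
    count (fun ab : 'I_N * 'I_N => cut_set N L R ab.2) net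
    + #|` L `\` R|%fset + #|` R `\` L|%fset)%N].
Proof.
pose cut := cut_set N L R.
have [pt [pt_inj ptX' pt_order]] := tie_broken_enumeration cut card_X.
have ptX p : reflect (exists i, p = pt i) (p \in X) by exact: equivP idP (ptX'
  p).
have inX i : pt i \in X by apply/ptX; exists i.
have horizontal i j k : i != j -> j != k -> i != k ->
    (pt i).2 = (pt j).2 -> (pt j).2 = (pt k).2 -> False.
  move=> ij jk ik yij yjk.
  apply: (gen_X (inX i) (inX j) (inX k)); rewrite ?(inj_eq pt_inj) //.
  exists (pt i), 0; rewrite !side0 -yjk yij subrr; split=> //.
  exact: direction_angle0.
have slope tau i j k : i != j -> j != k -> i != k ->
    slope_height tau (pt i) = slope_height tau (pt j) ->
    slope_height tau (pt j) = slope_height tau (pt k) -> False.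
  move=> ij jk ik hij hjk.
  apply: (gen_X (inX i) (inX j) (inX k)); rewrite ?(inj_eq pt_inj) //.
  have [theta [c [dir _ sideE]]] := slope_side tau.
  by exists (pt i), theta; rewrite !sideE -hjk hij subrr mulr0.
pose e := swap_order pt cut.
have eu : uniq e by exact: swap_order_uniq.
have em ij : (ij \in e) = (ij.1 < ij.2)%N by exact: mem_swap_order.
have et (i j k : 'I_N) : (i < j < k)%N ->
    (index (i, j) e < index (i, k) e < index (j, k) e)%N ||
    (index (j, k) e < index (i, k) e < index (i, j) e)%N.
  exact: swap_order_triple.
exists (swap_network e); split.
- exact: swap_network_adjacent.
- exact: swap_network_sorts.
- by rewrite size_map size_swap_order.
have mem_L k : k \in L -> (0 < k <= (N.-1)./2)%N.
  by move/(fsubsetP L_sub); rewrite in_fset mem_iota; lia.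
have mem_R k : k \in R -> (0 < k <= (N.-1)./2)%N.
  by move/(fsubsetP R_sub); rewrite in_fset mem_iota; lia.
have low := cut_set_low L_sub R_sub; have high := cut_set_high L_sub R_sub.
have sumI : (\sum_(k <- (L `&` R)%fset) num_ksets k X =
    \sum_(k <- (L `&` R)%fset) swaps_at k (swap_network e) +
    \sum_(k <- (L `&` R)%fset) swaps_at (N - k) (swap_network e))%N.
  rewrite -big_split /= !big_seq; apply: eq_bigr => k; rewrite in_fsetI.
  case/andP => kL kR; have kN := mem_L k kL.
  rewrite (num_ksetsE pt_inj ptX) (separated_tops_bottoms (cut := cut)) //.
  + by rewrite card_all_tops_bottoms //; lia.
  + lia.
  + by rewrite /cut low //; lia.
  + by rewrite /cut high //; lia.
have sumL : (\sum_(k <- (L `\` R)%fset) num_left_ksets k X =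
    \sum_(k <- (L `\` R)%fset) swaps_at k (swap_network e) + #|` L `\`
      R|%fset)%N.
  rewrite -sum1_size -big_split /= !big_seq; apply: eq_bigr => k;
    rewrite in_fsetD.
  case/andP => kR kL; have kN := mem_L k kL.
  rewrite (num_left_ksetsE pt_inj ptX) (separated_tops (cut := cut)) //.
  + by rewrite card_all_tops // addn1.
  + lia.
  + by rewrite /cut low //; lia.
  + by rewrite /cut high //; lia.
have sumR : (\sum_(k <- (R `\` L)%fset) num_right_ksets k X =
    \sum_(k <- (R `\` L)%fset) swaps_at (N - k) (swap_network e)
    + #|` R `\` L|%fset)%N.
  rewrite -sum1_size -big_split /= !big_seq; apply: eq_bigr => k;
    rewrite in_fsetD.
  case/andP => kL kR; have kN := mem_R k kR.
  rewrite (num_right_ksetsE pt_inj ptX) (separated_bottoms (cut := cut)) //.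
  + by rewrite card_all_bottoms // addn1.
  + lia.
  + by rewrite /cut low //; lia.
  + by rewrite /cut high //; lia.
rewrite /num_LRsets sumI sumL sumR count_cut_set //.
rewrite (sum_fsetID _ L R) (sum_fsetID _ R L).
by rewrite (fsetIC R L); ring.
Qed.

End KsetNetwork.

(** * The two bounds *)

Local Open Scope fset_scope.
Local Open Scope ring_scope.

(** The correction terms in [f] remove the two extra cardinals, so [f] counts the comparators at the
    cuts. All others are at the complementary cuts, and the same network bounds both diameters. *)
Lemma LRsets_bounds (RR : realType) (N : nat) (X : {fset RR * RR})
    (card_X : #|` X| = N) (gen_X : general_position X) (L R : {fset nat}) :
     L `<=` interval1 (N.-1)./2 -> R `<=` interval1 (N.-1)./2 ->
     let Lbar := interval1 N./2 `\` L in
     let Rbar := interval1 (N.-1)./2 `\` R in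
     let f := (num_LRsets L R X)%:Z - #|` L `|` R|%:Z + #|` L `&` R|%:Z in
     (diam_mp RR N L R)%:Z <= f /\
     f <= 'C(N, 2)%:Z - (diam_mp RR N Lbar Rbar)%:Z.
Proof.
move=> L_sub R_sub Lbar Rbar f.
have [net [adj sorts net_size num]] := kset_network card_X gen_X L_sub R_sub.
have fE : f = count (fun ab : 'I_N * 'I_N => cut_set N L R ab.2) net :> int.
  have := cardfsU L R; have := cardfsID R L; have := cardfsID L R.
  by rewrite /f num (fsetIC R L); lia.
have mem_int (S : {fset nat}) m : S `<=` interval1 m ->
    forall c, c \in S -> (0 < c <= m)%N.
  by move=> /fsubsetP Sm c /Sm; rewrite in_fset mem_iota; lia.
have bound_LR c : (c \in L -> c < N)%N /\ (c \in R -> 0 < c < N)%N.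
  by split=> [/(mem_int _ _ L_sub)|/(mem_int _ _ R_sub)]; lia.
have bound_bar c : (c \in Lbar -> c < N)%N /\ (c \in Rbar -> 0 < c < N)%N.
  by split; rewrite in_fsetD => /andP[_ /(mem_int _ _ (fsubset_refl _))]; lia.
split; first by rewrite fE lez_nat; exact: diam_mp_network.
have := diam_mp_network bound_bar RR adj sorts.
have -> : count (fun ab : 'I_N * 'I_N => cut_set N Lbar Rbar ab.2) net =
    count (predC (fun ab : 'I_N * 'I_N => cut_set N L R ab.2)) net.
  apply: eq_in_count => ab abnet /=; apply: cut_set_compl => //.
  by rewrite ltn_ord (adj _ abnet).
have := count_predC (fun ab : 'I_N * 'I_N => cut_set N L R ab.2) net.
by rewrite fE -net_size; lia.
Qed.

Theorem theorem4p1 (RR : realType) (N : nat) (X : {fset RR * RR})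
    (card_X : #|` X| = N) (gen_X : general_position X) :
  (forall L R : {fset nat},
     L `<=` interval1 (N.-1)./2 -> R `<=` interval1 (N.-1)./2 ->
     let Lbar := interval1 N./2 `\` L in
     let Rbar := interval1 (N.-1)./2 `\` R in
     let f := (num_LRsets L R X)%:Z - #|` L `|` R|%:Z + #|` L `&` R|%:Z in
     (diam_mp RR N L R)%:Z <= f /\
     f <= 'C(N, 2)%:Z - (diam_mp RR N Lbar Rbar)%:Z) /\
  (forall K : {fset nat},
     K `<=` interval1 (N.-1)./2 ->
     let Kbar1 := interval1 N./2 `\` K in
     let Kbar2 := interval1 (N.-1)./2 `\` K in
     (diam_mp RR N K K)%:Z <= (num_LRsets K K X)%:Z /\
     (num_LRsets K K X)%:Z
       <= 'C(N, 2)%:Z - (diam_mp RR N Kbar1 Kbar2)%:Z).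
Proof.
split=> [L R|K] L_sub; first exact: LRsets_bounds.
have := LRsets_bounds card_X gen_X L_sub L_sub.
by rewrite /= fsetUid fsetIid subrK.
Qed.
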